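(* Let $\Phi$ be an $N$-function whose Matuszewska-Orlicz indices satisfy $1<\alpha_\Phi\le\beta_\Phi<\infty$, let $0<\theta<2\min\{1/\beta_\Phi,1-1/\alpha_\Phi\}$, and let $\Phi_\theta:=\widetilde\Psi_\theta^{-1}$, where $\widetilde\Psi_\theta$ is the least concave majorant of the function $\Psi_\theta$ given by $\Psi_\theta(0):=0$, $\Psi_\theta(t):=\left(\Phi^{-1}(t)\,t^{-\theta/2}\right)^{1/(1-\theta)}$ for $t>0$. Then there exists a constant $C_{\Phi,\theta}\in(0,\infty)$ such that for every linear operator $$T:\ell^{\Phi_\theta}(\mathbb{Z})+\ell^2(\mathbb{Z})\to\ell^{\Phi_\theta}(\mathbb{Z})+\ell^2(\mathbb{Z})$$ with $T\in\mathcal{B}(\ell^{\Phi_\theta}(\mathbb{Z}))$ and $T\in\mathcal{B}(\ell^2(\mathbb{Z}))$, one has $T\in\mathcal{B}(\ell^\Phi(\mathbb{Z}))$ and $$\|T\|_{\mathcal{B}(\ell^\Phi(\mathbb{Z}))}\le C_{\Phi,\theta}\,\|T\|_{\mathcal{B}(\ell^{\Phi_\theta}(\mathbb{Z}))}^{1-\theta}\,\|T\|_{\mathcal{B}(\ell^2(\mathbb{Z}))}^{\theta}.$$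
   Context: An $N$-function is a continuous, increasing, convex function $\Phi:[0,\infty)\to[0,\infty)$ with $\Phi(t)=0$ iff $t=0$, $\lim_{t\to0^+}\Phi(t)/t=0$ and $\lim_{t\to\infty}\Phi(t)/t=\infty$. The Orlicz sequence space $\ell^\Phi(\mathbb{Z})$ consists of all $f=\{f_n\}:\mathbb{Z}\to\mathbb{C}$ with $\varrho_\Phi(f/\lambda):=\sum_{n\in\mathbb{Z}}\Phi(|f_n/\lambda|)<\infty$ for some $\lambda>0$, normed by $\|f\|_{\ell^\Phi(\mathbb{Z})}:=\inf\{\lambda>0:\varrho_\Phi(f/\lambda)\le1\}$. For $t>0$ let $M(t,\Phi):=\sup_{0<u<\infty}\Phi(tu)/\Phi(u)\in(0,\infty]$. The Matuszewska-Orlicz indices are $\alpha_\Phi:=\sup_{0<t<1}\frac{\ln M(t,\Phi)}{\ln t}$ and $\beta_\Phi:=\inf_{t>1}\frac{\ln M(t,\Phi)}{\ln t}$. For $\Psi:[0,\infty)\to[0,\infty)$ with $\Psi(t)=0$ iff $t=0$, its least concave majorant $\widetilde\Psi$ is the pointwise infimum of all concave functions $F:[0,\infty)\to[0,\infty)$ with $F(t)=0$ iff $t=0$ and $\Psi\le F$ on $[0,\infty)$. The notation $\Phi^{-1}$, $\widetilde\Psi_\theta^{-1}$ means inverse functions on $[0,\infty)$. The condition on $\theta$ forces $\theta<1$, and under the stated hypotheses $\Phi_\theta$ is an $N$-function with $1<\alpha_{\Phi_\theta}\le\beta_{\Phi_\theta}<\infty$. $\mathcal{B}(\mathcal{X})$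 is the algebra of bounded linear operators on $\mathcal{X}$; ''$T\in\mathcal{B}(Y)$'' for a space $Y$ of sequences means that $T$ maps $Y$ into $Y$ and is bounded there. *)

(* Defs.v *)
From HB Require Import structures.
From mathcomp Require Import all_boot all_order all_algebra.
From mathcomp Require Import complex.
From mathcomp Require Import all_classical all_reals all_analysis.

Set Implicit Arguments.
Unset Strict Implicit.
Unset Printing Implicit Defensive.

Import Order.TTheory GRing.Theory Num.Theory.
Import numFieldNormedType.Exports.

Local Open Scope classical_set_scope.
Local Open Scope ring_scope.

(* Functions on the half line [0, +oo) are total functions R -> R of which only
   the restriction to `[0, +oo[ is meaningful; every definition below looks at
   that restriction only. *)

Section Functions.
Variable R : realType.
Implicit Types (Phi Psi F : R -> R) (t theta : R).

Record N_function Phi : Prop := {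
  N_function_ge0 : forall t, 0 <= t -> 0 <= Phi t ;
  N_function_continuous : {within `[0, +oo[, continuous Phi} ;
  N_function_increasing : {in `[0, +oo[ &, {homo Phi : s t / s < t}} ;
  N_function_convex : convex_function (`[0, +oo[ : set R^o) (Phi : R^o -> R^o) ;
  N_function_eq0 : forall t, 0 <= t -> (Phi t = 0 <-> t = 0) ;
  N_function_at0 : Phi t / t @[t --> 0^'+] --> 0 ;
  N_function_infty : Phi t / t @[t --> +oo] --> +oo
}.

(* Values in (0, +oo]: the supremum is taken in the extended reals. *)
Definition dilation_sup t Phi : \bar R :=
  ereal_sup [set (Phi (t * u) / Phi u)%:E | u in `]0, +oo[].

Definition MO_alpha Phi : \bar R :=
  ereal_sup [set (lne (dilation_sup t Phi) * ((ln t)^-1)%:E)%E | t in `]0, 1[].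

Definition MO_beta Phi : \bar R :=
  ereal_inf [set (lne (dilation_sup t Phi) * ((ln t)^-1)%:E)%E | t in `]1, +oo[].

Definition inverse_half_line Phi : R -> R :=
  'pinv_(fun=> 0) `[0, +oo[ Phi.

Definition concave_above Psi F : Prop :=
  [/\ forall t, 0 <= t -> 0 <= F t,
      convex_function (`[0, +oo[ : set R^o) ((fun t => - F t) : R^o -> R^o),
      forall t, 0 <= t -> (F t = 0 <-> t = 0)
    & forall t, 0 <= t -> Psi t <= F t].

Definition least_concave_majorant Psi : R -> R :=
  fun t => inf [set F t | F in concave_above Psi].

Definition Psi_theta Phi theta : R -> R := fun t =>
  if t == 0 then 0
  else (inverse_half_line Phi t * t `^ (- (theta / 2))) `^ (1 - theta)^-1.

Definition Phi_theta Phi theta : R -> R :=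
  inverse_half_line (least_concave_majorant (Psi_theta Phi theta)).

End Functions.

Section Spaces.
Variable R : realType.
Implicit Types (Phi : R -> R) (f g : int -> R[i]) (X Y : set (int -> R[i])).

Definition modulus : R[i] -> R := @ComplexField.Normc.normc R.

Definition modular Phi f : \bar R :=
  \esum_(n in [set: int]) (Phi (modulus (f n)))%:E.

Definition seq_div f (l : R) : int -> R[i] := fun n => f n / (l%:C)%C.

Definition orlicz Phi : set (int -> R[i]) :=
  [set f | exists2 l : R, 0 < l & (modular Phi (seq_div f l) < +oo)%E].

Definition orlicz_norm Phi f : R :=
  inf [set l : R | 0 < l /\ (modular Phi (seq_div f l) <= 1)%E].

Definition ell2_sum f : \bar R :=
  \esum_(n in [set: int]) (modulus (f n) ^+ 2)%:E.

Definition ell2 : set (int -> R[i]) := [set f | (ell2_sum f < +oo)%E].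

Definition ell2_norm f : R := Num.sqrt (fine (ell2_sum f)).

Definition sum_space X Y : set (int -> R[i]) :=
  [set (fun n => g n + h n) | g in X & h in Y].

(* An operator with domain a space Y of sequences is a total map of which only
   the restriction to Y is meaningful. *)
Definition linear_operator Y (T : (int -> R[i]) -> (int -> R[i])) : Prop :=
  (forall f, Y f -> Y (T f)) /\
  (forall (a : R[i]) f g, Y f -> Y g ->
     T (fun n => a * f n + g n) = (fun n => a * T f n + T g n)).

Definition bounded_operator Y (N : (int -> R[i]) -> R)
    (T : (int -> R[i]) -> (int -> R[i])) : Prop :=
  (forall f, Y f -> Y (T f)) /\
  (exists c : R, forall f, Y f -> N (T f) <= c * N f).

Definition operator_norm Y (N : (int -> R[i]) -> R)
    (T : (int -> R[i]) -> (int -> R[i])) : R :=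
  sup [set N (T f) | f in [set f | Y f /\ N f <= 1]].

End Spaces.

(* Main.v *)
(* Elementary form of the Gustavsson-Peetre argument.  If sum_n Phi |f_n| <= 1,
   put t_n = Phi |f_n|, g0 = Psi~(t_n), g1 = sqrt(t_n): these lie in the unit
   balls of l^{Phi_theta} and l^2, and |f| <= g0^(1-theta) g1^theta.  Split f
   dyadically into pieces f_k on which g0/g1 ~ 2^k.  All sums
   sum_k +-2^(k theta) f_k are bounded by g0, so averaging over signs bounds
   sup_k 2^(k theta) |T f_k| in l^{Phi_theta}; likewise
   sup_k 2^(-k (1-theta)) |T f_k| in l^2.  Summing the smaller of the two bounds
   over k gives |T f| <= C h0^(1-theta) h1^theta, and Psi~ <= K Psi_theta, which
   follows from the conditions on the indices, turns this back into a bound in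
   l^Phi. *)

Require Import Defs.
From HB Require Import structures.
From mathcomp Require Import all_boot all_order all_algebra.
From mathcomp Require Import complex.
From mathcomp Require Import all_classical all_reals all_analysis.
From mathcomp Require Import ring lra.

Set Implicit Arguments.
Unset Strict Implicit.
Unset Printing Implicit Defensive.

Import Order.TTheory GRing.Theory Num.Theory.
Import numFieldNormedType.Exports.

Local Open Scope classical_set_scope.
Local Open Scope ring_scope.

(** Nothing says that [T] commutes with the infinite dyadic sum of the f_k. Only finitely many
    pieces are therefore used. On the two remaining tails g0/g1 is very large or very small; there f
    is a small multiple of an element of a unit ball, so [T] sends it to a sequence that is
    uniformly below eps. This eps is absorbed on each finite set of indices separately, where the
    nonzero values of |T f| have a positive minimum.

    The upper bound on theta splits into two conditions: theta/2 < 1/beta makes Psi_theta(t) almost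
    increasing, and theta/2 < 1 - 1/alpha makes Psi_theta(t)/t almost decreasing. Together they give
    Psi_theta(s) <= K (1 + s/t) Psi_theta(t), hence for each t an affine majorant that is within a
    factor 2K of Psi_theta at t.

    Operator norms enter only through numbers M strictly above them, for which [T] maps the modular
    unit ball into M times itself. Letting M decrease to the norm is the last step and includes
    norms equal to 0. *)

Section Modulus.
Variable R : realType.
Implicit Types (x y : R[i]) (r : R).

Lemma modulus_ge0 x : 0 <= modulus x.
Proof. by case: x => a b; exact: sqrtr_ge0. Qed.

Lemma modulus0 : modulus (0 : R[i]) = 0.
Proof. exact: ComplexField.Normc.normc0. Qed.

Lemma modulusM x y : modulus (x * y) = modulus x * modulus y.
Proof. exact: ComplexField.Normc.normcM. Qed.

Lemma modulusV x : modulus x^-1 = (modulus x)^-1.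
Proof. exact: ComplexField.Normc.normcV. Qed.

Lemma modulusD x y : modulus (x + y) <= modulus x + modulus y.
Proof. exact: (@le_normcD R x y). Qed.

Lemma modulusN x : modulus (- x) = modulus x.
Proof. exact: (@normcN R x). Qed.

Lemma modulus_real r : modulus (r%:C)%C = `|r|.
Proof. by rewrite /modulus /= expr0n /= addr0 sqrtr_sqr. Qed.

Lemma modulus_div_real x r : 0 < r -> modulus (x / (r%:C)%C) = modulus x / r.
Proof. by move=> r0; rewrite modulusM modulusV modulus_real gtr0_norm. Qed.

Lemma modulus_sum (I : Type) (s : seq I) (P : pred I) (F : I -> R[i]) :
  modulus (\sum_(i <- s | P i) F i) <= \sum_(i <- s | P i) modulus (F i).
Proof.
elim/big_ind2 : _ => [|x r y t xr yt|i _]; rewrite ?modulus0 //.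
by rewrite (le_trans (modulusD _ _)) // lerD.
Qed.

Lemma modulus_sign (b : bool) x : modulus ((-1) ^+ b * x) = modulus x.
Proof. by case: b; rewrite ?expr0 ?expr1 ?mul1r // mulN1r modulusN. Qed.

(* Flipping every sign except the j-th one turns the signed sum S into S' with
   S + S' = +- 2 x j. *)
Lemma sign_average (I : finType) (x : I -> R[i]) (j : I) :
  modulus (x j) <= (\sum_(e : {ffun I -> bool})
    modulus (\sum_i (-1) ^+ e i * x i)) / #|{ffun I -> bool}|%:R.
Proof.
pose S (e : {ffun I -> bool}) := \sum_i (-1) ^+ e i * x i.
pose flip (e : {ffun I -> bool}) := [ffun i => if i == j then e i else ~~ e i].
have flipK : involutive flip.
  by move=> e; apply/ffunP => i; rewrite !ffunE; case: eqP => // _; rewrite negbK.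
have SE e : S e + S (flip e) = (-1) ^+ e j * x j *+ 2.
  rewrite -big_split /= (bigD1 j) //= ffunE eqxx big1 ?addr0 // => i ij.
  by rewrite ffunE (negbTE ij); case: (e i); rewrite /= ?expr0 ?expr1; ring.
have key e : 2 * modulus (x j) <= modulus (S e) + modulus (S (flip e)).
  rewrite (le_trans _ (modulusD _ _)) // SE -(mulr_natl (_ * _)) modulusM modulus_sign.
  by rewrite -[2%:R in leRHS](rmorph_nat (real_complex R)) modulus_real ger0_norm.
have : \sum_(e : {ffun I -> bool}) 2 * modulus (x j) <=
       \sum_(e : {ffun I -> bool}) (modulus (S e) + modulus (S (flip e))).
  by apply: ler_sum => e _; exact: key.
have flipS : \sum_e modulus (S (flip e)) = \sum_e modulus (S e).
  by rewrite [RHS](reindex_inj (inv_inj flipK)).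
rewrite big_split /= flipS sumr_const -mulr_natr.
set n := #|_|; set Q := \sum_e _ => h.
have n0 : 0 < n%:R :> R by rewrite ltr0n; apply/card_gt0P; exists [ffun=> true].
rewrite ler_pdivlMr //; move: h; rewrite -/Q -/n; lra.
Qed.

End Modulus.

(** * Sums over the integers through their finite partial sums *)

Section Sums.
Variable R : realType.
Implicit Types (a b : int -> R) (B : R).

(** Real-valued stand-in for [\esum] bounded by [B]: every estimate can be made on one finite list
    of indices at a time. *)
Definition sums_le a B := forall s : seq int, uniq s -> \sum_(n <- s) a n <= B.

Lemma esum_leP a B :
  (\esum_(n in [set: int]) (a n)%:E <= B%:E)%E <-> sums_le a B.
Proof.
split=> [h s us|h].
  rewrite -lee_fin -sumEFin (le_trans _ h) //; apply: ereal_sup_ubound => /=.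
  exists [set` s]; last by rewrite -fsbig_seq.
  by split => //; exact: finite_seq.
rewrite /esum; apply: ge_ereal_sup => x [A [fA _] <-].
by rewrite fsbig_finite //= sumEFin lee_fin; exact/h/finmap.fset_uniq.
Qed.

Lemma esum_lt_pinftyP a : (forall n, 0 <= a n) ->
  (\esum_(n in [set: int]) (a n)%:E < +oo)%E <-> exists B, sums_le a B.
Proof.
move=> a0; split => [h|[B /esum_leP h]]; last first.
  by rewrite (le_lt_trans h) // ltry.
have e0 : (0 <= \esum_(n in [set: int]) (a n)%:E)%E.
  by apply: esum_ge0 => n _; rewrite lee_fin.
exists (fine (\esum_(n in [set: int]) (a n)%:E)); apply/esum_leP.
by rewrite fineK // ge0_fin_numE.
Qed.

Lemma sums_le_mono a b B : (forall n, a n <= b n) -> sums_le b B -> sums_le a B.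
Proof. by move=> ab hb s us; apply: le_trans (hb s us); apply: ler_sum. Qed.

Lemma sums_leW a B B' : B <= B' -> sums_le a B -> sums_le a B'.
Proof. by move=> BB h s us; apply: le_trans (h s us) BB. Qed.

Lemma sums_leD a b B B' : sums_le a B -> sums_le b B' ->
  sums_le (fun n => a n + b n) (B + B').
Proof. by move=> ha hb s us; rewrite big_split /= lerD ?ha ?hb. Qed.

Lemma sums_leZ a B c : 0 <= c -> sums_le a B -> sums_le (fun n => c * a n) (c * B).
Proof. by move=> c0 h s us; rewrite -mulr_sumr ler_wpM2l ?h. Qed.

Lemma sums_le_sum (I : finType) (a : I -> int -> R) B :
  (forall i, sums_le (a i) B) -> sums_le (fun n => \sum_i a i n) (#|I|%:R * B).
Proof.
move=> h s us; rewrite exchange_big /= mulr_natl -sumr_const.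
by apply: ler_sum => i _; exact: h.
Qed.

Lemma sums_le_single a B n : sums_le a B -> a n <= B.
Proof. by move=> /(_ [:: n]); rewrite big_seq1; apply. Qed.

Lemma sums_le_ge0 a B : sums_le a B -> 0 <= B.
Proof. by move=> /(_ [::]); rewrite big_nil; apply. Qed.

End Sums.

(** * Convex functions, their modulars and Luxemburg norms *)

Section Young.
Variable R : realType.
Implicit Types (Y : R -> R) (f g : int -> R[i]).

(** The common ground of [Phi], [Phi_theta] and the square function, so that l^2 is handled as one
    more Orlicz space. *)
Record young Y : Prop := {
  young_ge0 : forall x, 0 <= x -> 0 <= Y x ;
  young_le : forall x y, 0 <= x -> x <= y -> Y x <= Y y ;
  young0 : Y 0 = 0 ;
  young_convex : forall p x y, 0 <= p <= 1 -> 0 <= x -> 0 <= y ->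
    Y (p * x + (1 - p) * y) <= p * Y x + (1 - p) * Y y
}.

Variable Y : R -> R.
Hypothesis yY : young Y.

Lemma youngZ p x : 0 <= p <= 1 -> 0 <= x -> Y (p * x) <= p * Y x.
Proof.
move=> p01 x0; have := young_convex yY p01 x0 (lexx 0).
by rewrite !mulr0 !addr0 (young0 yY) mulr0 addr0.
Qed.

(** Jensen's inequality with equal weights: the head gets weight 1/(size + 1) and the average of the
    tail gets the rest. On the empty list division by 0 returns 0, and [Y 0 = 0]. *)
Lemma young_average_seq (I : eqType) (s : seq I) (x : I -> R) :
  (forall i, 0 <= x i) ->
  Y ((\sum_(i <- s) x i) / (size s)%:R) <= (\sum_(i <- s) Y (x i)) / (size s)%:R.
Proof.
move=> x0; elim: s => [|i s ih].
  by rewrite !big_nil !mul0r (young0 yY).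
rewrite !big_cons /=; have [->|s0] := eqVneq s [::].
  by rewrite !big_nil !addr0 !divr1.
have n0 : 0 < (size s)%:R :> R by rewrite ltr0n lt0n size_eq0.
have m0 : 0 < (size s).+1%:R :> R by rewrite ltr0n.
set p : R := (size s).+1%:R^-1.
have p01 : 0 <= p <= 1 by rewrite /p invr_ge0 ltW // invf_le1 // ler1n.
have pE : 1 - p = (size s)%:R / (size s).+1%:R.
  by rewrite /p -natr1; field; rewrite natr1 lt0r_neq0.
have E (u v : R) : (u + v) / (size s).+1%:R = p * u + (1 - p) * (v / (size s)%:R).
  by rewrite pE /p; field; rewrite !lt0r_neq0.
rewrite !E (le_trans (young_convex yY p01 _ _)) //.
  by rewrite divr_ge0 ?sumr_ge0 ?ler0n.
by rewrite lerD2l ler_wpM2l // subr_ge0; case/andP: p01.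
Qed.

Lemma young_average (I : finType) (x : I -> R) : (forall i, 0 <= x i) ->
  Y ((\sum_i x i) / #|I|%:R) <= (\sum_i Y (x i)) / #|I|%:R.
Proof.
by move=> x0; rewrite -!big_enum cardT /=; exact: young_average_seq.
Qed.

Lemma modular_divE f l : 0 < l ->
  modular Y (seq_div f l) = \esum_(n in [set: int]) (Y (modulus (f n) / l))%:E.
Proof.
by move=> l0; apply: eq_esum => n _; rewrite /seq_div modulus_div_real.
Qed.

Lemma modular_div_leP f l B : 0 < l ->
  (modular Y (seq_div f l) <= B%:E)%E <->
  sums_le (fun n => Y (modulus (f n) / l)) B.
Proof. by move=> l0; rewrite modular_divE //; exact: esum_leP. Qed.

(* By convexity a finite modular can be pushed below 1 by enlarging l. *)
Lemma orliczP f : orlicz Y f <->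
  exists2 l : R, 0 < l & sums_le (fun n => Y (modulus (f n) / l)) 1.
Proof.
split => [[l l0]|[l l0 h]]; last first.
  by exists l => //; rewrite (le_lt_trans _ (ltry 1)) //; apply/modular_div_leP.
rewrite modular_divE // => /esum_lt_pinftyP [n|B hB].
  by apply: (young_ge0 yY); rewrite divr_ge0 ?modulus_ge0 // ltW.
have B0 := sums_le_ge0 hB; have B1 : 0 < B + 1 by lra.
exists ((B + 1) * l); first by rewrite mulr_gt0.
apply: (@sums_leW _ _ ((B + 1)^-1 * B)); first by rewrite mulrC ler_pdivrMr //; lra.
apply: sums_le_mono (sums_leZ _ hB) => [n|]; last by rewrite invr_ge0 ltW.
rewrite invfM mulrCA; apply: youngZ.
  by rewrite invr_ge0 ltW // invf_le1 //; lra.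
by rewrite divr_ge0 ?modulus_ge0 // ltW.
Qed.

Lemma young_div_le f l l' B : 0 < l -> l <= l' ->
  sums_le (fun n => Y (modulus (f n) / l)) B ->
  sums_le (fun n => Y (modulus (f n) / l')) B.
Proof.
move=> l0 ll'; apply: sums_le_mono => n; apply: (young_le yY).
  by rewrite divr_ge0 ?modulus_ge0 // (le_trans (ltW l0)).
by rewrite ler_wpM2l ?modulus_ge0 // lef_pV2 // posrE (lt_le_trans l0).
Qed.

Lemma orlicz_combination (a : R[i]) f g : orlicz Y f -> orlicz Y g ->
  orlicz Y (fun n => a * f n + g n).
Proof.
move=> /orliczP[l l0 hf] /orliczP[k k0 hg]; apply/orliczP.
have a0 := modulus_ge0 a.
(* A scale above both [modulus a * l] and [k]. The factor 2 turns the sum into a midpoint, where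
   convexity costs half of each modular. *)
exists (2 * (modulus a * l + l + k)).
  by rewrite mulr_gt0 // ltr_wpDl // addr_ge0 ?mulr_ge0 // ltW.
have := sums_leZ (_ : 0 <= 2^-1) (sums_leD hf hg).
rewrite (_ : 2^-1 * (1 + 1) = 1 :> R); last by field.
move=> /(_ (ltac:(by rewrite invr_ge0))); apply: sums_le_mono => n.
have x0 := modulus_ge0 (f n); have y0 := modulus_ge0 (g n).
set L := _ + _ + _.
have al : 0 <= modulus a * l by rewrite mulr_ge0 // ltW.
have L0 : 0 < L by rewrite /L; lra.
have p : 0 <= (2^-1 : R) <= 1 by lra.
have := young_convex yY p (divr_ge0 x0 (ltW l0)) (divr_ge0 y0 (ltW k0)).
rewrite (_ : 1 - 2^-1 = 2^-1) -?mulrDr; last by field.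
apply: le_trans; apply: (young_le yY).
  by rewrite divr_ge0 ?modulus_ge0 // mulr_ge0 // ltW.
rewrite invfM mulrCA ler_wpM2l // ?invr_ge0 //.
rewrite ler_pdivrMr // (le_trans (modulusD _ _)) // modulusM mulrDl lerD //.
  rewrite mulrAC -mulrA mulrC ler_wpM2l //.
  by rewrite ler_pdivlMr // /L; lra.
rewrite mulrAC -mulrA ler_peMr // ler_pdivlMr // /L; lra.
Qed.

Lemma orlicz_norm_le f l : 0 < l ->
  sums_le (fun n => Y (modulus (f n) / l)) 1 -> orlicz_norm Y f <= l.
Proof.
move=> l0 h; apply: ge_inf; first by exists 0 => x [/ltW].
by split => //; apply/modular_div_leP.
Qed.

Lemma orlicz_norm_ge0 f : orlicz Y f -> 0 <= orlicz_norm Y f.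
Proof.
move=> /orliczP[k k0 hk]; apply: lb_le_inf => [|x [/ltW]//].
by exists k; split => //; apply/modular_div_leP.
Qed.

(** Strictness yields an admissible scale below [l] without asking whether the infimum is attained.
    This is why operator norms are later replaced by strictly larger numbers. *)
Lemma orlicz_norm_lt f l : orlicz Y f -> orlicz_norm Y f < l ->
  sums_le (fun n => Y (modulus (f n) / l)) 1.
Proof.
move=> /orliczP[k k0 hk] fl.
have [|x [x0 hx] xl] := @inf_lt _
  [set l : R | 0 < l /\ (modular Y (seq_div f l) <= 1)%E] l _ fl.
  by exists k; split => //; apply/modular_div_leP.
by apply: (young_div_le x0 (ltW xl)); apply/modular_div_leP.
Qed.

End Young.

(** * Geometric sums and power inequalities behind the summation over dyadic levels *)

Section TruncatedGeometricSums.
Variable R : realFieldType.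
Implicit Types (u q : R).

(** The bound is uniform in [u] and [N] because the surviving terms form a geometric tail whose
    first term is at most 1. *)
Lemma truncated_geom_decreasing u q N : 0 <= u -> 0 <= q < 1 ->
  \sum_(m < N) (if u * q ^+ m <= 1 then u * q ^+ m else 0) <= (1 - q)^-1.
Proof.
move=> u0 /andP[q0 q1]; have q1' : 0 < 1 - q by rewrite subr_gt0.
have small v : 0 <= v <= 1 ->
    \sum_(m < N) (if v * q ^+ m <= 1 then v * q ^+ m else 0) <= v * (1 - q)^-1.
  elim: N v => [|N ih] v /andP[v0 v1].
    by rewrite big_ord0 mulr_ge0 // invr_ge0 ltW.
  rewrite big_ord_recl expr0 mulr1 v1.
  under eq_bigr do rewrite exprS mulrA.
  rewrite (le_trans (lerD (lexx _) (ih _ _))).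
  - by [].
  - by rewrite mulr_ge0 //= (le_trans (ler_wpM2l v0 (ltW q1))) // mulr1.
  - by rewrite le_eqVlt; apply/orP; left; apply/eqP; field; rewrite lt0r_neq0.
elim: N u u0 small => [|N ih] u u0 small.
  by rewrite big_ord0 invr_ge0 ltW.
have [u1|u1] := leP u 1.
  rewrite (le_trans (small u _)) ?u0 //.
  by rewrite -[leRHS]mul1r ler_wpM2r // invr_ge0 ltW.
rewrite big_ord_recl expr0 mulr1 [u <= 1]leNgt u1 add0r.
under eq_bigr do rewrite exprS mulrA.
apply: ih; first by rewrite mulr_ge0.
(* The hypothesis [small] depends on [N]; its version for [N] follows from that for [N.+1] by
   dropping a nonnegative last term. *)
move=> v v01; apply: le_trans (small v v01).
rewrite big_ord_recr /= lerDl; case: ifP => // _.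
by rewrite mulr_ge0 ?exprn_ge0 //; case/andP: v01.
Qed.

Lemma truncated_geom_increasing u q N : 0 <= u -> 1 < q ->
  \sum_(m < N) (if u * q ^+ m <= 1 then u * q ^+ m else 0) <= q / (q - 1).
Proof.
move=> u0 q1; have q1' : 0 < q - 1 by rewrite subr_gt0.
have q0 : 0 < q by rewrite (lt_trans ltr01).
(* The induction also carries the untruncated geometric bound. If the last term survives,
   [u * q ^+ N <= 1] turns that bound into the uniform one. *)
suff [] : \sum_(m < N) (if u * q ^+ m <= 1 then u * q ^+ m else 0) <=
    u * q ^+ N / (q - 1) /\
  \sum_(m < N) (if u * q ^+ m <= 1 then u * q ^+ m else 0) <= q / (q - 1) by [].
elim: N => [|N [ih1 ih2]].
  by rewrite big_ord0 expr0 mulr1 !divr_ge0 // ltW.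
have un : 0 <= u * q ^+ N by rewrite mulr_ge0 // exprn_ge0 // ltW.
have E : u * q ^+ N.+1 / (q - 1) = u * q ^+ N / (q - 1) + u * q ^+ N.
  by rewrite exprS; field; rewrite lt0r_neq0.
rewrite big_ord_recr /= E; case: ifP => h; last first.
  rewrite addr0; split => //; rewrite (le_trans ih1) // lerDl //.
split; first by rewrite lerD2r.
rewrite (le_trans (lerD ih1 (lexx _))) // -E exprS mulrCA.
by rewrite ler_wpM2r ?invr_ge0 ?(ltW q1') // -[leRHS]mulr1 ler_wpM2l // ltW.
Qed.

End TruncatedGeometricSums.

Section PowerInequalities.
Variable R : realType.
Implicit Types (a b c f r theta : R).

Lemma powR_complement a theta : a `^ (1 - theta) * a `^ theta = a `^ 1.
Proof. by rewrite -powRD ?subrK ?oner_eq0. Qed.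

(** Where a/b is at least [c], moving [c] inside the second power gives a^(1-theta) (c b)^theta, and
    c b is at most a. *)
Lemma le_product_high a b c f theta : 0 < theta < 1 -> 0 <= a -> 0 <= b ->
  0 < c -> f <= a `^ (1 - theta) * b `^ theta -> c * b <= a ->
  c `^ theta * f <= a.
Proof.
move=> th a0 b0 c0 hf cb.
rewrite (le_trans (ler_wpM2l (powR_ge0 _ _) hf)) // mulrCA.
rewrite -powRM ?(ltW c0) // -[leRHS]powRr1 // -(powR_complement _ theta).
rewrite ler_wpM2l ?powR_ge0 //; case/andP: th => th0 _.
by rewrite ge0_ler_powR // ?nnegrE ?mulr_ge0 // ltW.
Qed.

Lemma le_product_low a b c f theta : 0 < theta < 1 -> 0 <= a -> 0 <= b ->
  0 < c -> f <= a `^ (1 - theta) * b `^ theta -> a <= c * b ->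
  c `^ (- (1 - theta)) * f <= b.
Proof.
move=> th a0 b0 c0 hf cb; have /andP[th0 th1] := th.
rewrite powRN mulrC ler_pdivrMr ?powR_gt0 // (le_trans hf) //.
rewrite -[X in _ <= X * _](powRr1 b0) -(powR_complement _ theta) mulrAC.
rewrite ler_wpM2r ?powR_ge0 // -powRM ?(ltW c0) // [b * c]mulrC.
rewrite ge0_ler_powR // ?nnegrE ?mulr_ge0 // ?subr_ge0 ltW //.
Qed.

(** The geometric sums of ratio 2^(-theta) for the levels above the balance point and 2^(1-theta)
    for those below. The factor 2 bounds the 2^(1-theta) lost because the second bound is taken at
    the upper end of each dyadic band. *)
Definition calderon_constant theta : R :=
  (1 - 2 `^ (- theta))^-1 + 2 * (2 `^ (1 - theta) / (2 `^ (1 - theta) - 1)).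

Lemma powR2_gt1 theta : 0 < theta -> 1 < 2 `^ theta :> R.
Proof.
move=> th0; have {1}<- : 1 `^ theta = 1 :> R by rewrite powR1.
by rewrite gt0_ltr_powR ?nnegrE ?ltr1n.
Qed.

Lemma powR2N_lt1 theta : 0 < theta -> 0 <= (2 : R) `^ (- theta) < 1.
Proof.
by move=> th0; rewrite powR_ge0 powRN invf_lt1 ?powR_gt0 // powR2_gt1.
Qed.

Lemma calderon_constant_gt0 theta : 0 < theta < 1 -> 0 < calderon_constant theta.
Proof.
move=> /andP[th0 th1]; have /andP[_ h] := powR2N_lt1 th0.
have th1' : 0 < 1 - theta by rewrite subr_gt0.
have h' := powR2_gt1 th1'.
rewrite ltr_wpDr ?invr_gt0 ?subr_gt0 // mulr_ge0 // divr_ge0 ?powR_ge0 //.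
by rewrite subr_ge0 ltW.
Qed.

(* For each m the smaller of the two bounds is used; in units of
   a^(1-theta) b^theta they are t^-theta and (2 t)^(1-theta) with
   t = r 2^m b / a. *)
Lemma calderon_sum a b r theta N (x : 'I_N -> R) : 0 < theta < 1 ->
  0 <= a -> 0 <= b -> 0 < r -> (forall m, 0 <= x m) ->
  (forall m : 'I_N, (r * 2 ^+ m) `^ theta * x m <= a) ->
  (forall m : 'I_N, (r * 2 ^+ m.+1) `^ (- (1 - theta)) * x m <= b) ->
  \sum_m x m <= calderon_constant theta * (a `^ (1 - theta) * b `^ theta).
Proof.
move=> th a0 b0 r0 x0 xa xb; have /andP[th0 th1] := th.
have th1' : 0 < 1 - theta by rewrite subr_gt0.
have c0 (m : nat) : 0 < r * 2 ^+ m by rewrite mulr_gt0 // exprn_gt0.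
have C0 := ltW (calderon_constant_gt0 th).
have allz : (forall m, x m <= 0) ->
    \sum_m x m <= calderon_constant theta * (a `^ (1 - theta) * b `^ theta).
  move=> h; rewrite (le_trans (_ : _ <= 0)) //; first exact: sumr_le0.
  by rewrite !mulr_ge0 ?powR_ge0.
(* If [a] or [b] vanishes, the bounds force every [x m] to be at most 0; otherwise both may be
   divided by. *)
move: a0; rewrite le_eqVlt => /predU1P[a0|a0].
  apply: allz => m; rewrite -(pmulr_rle0 _ (powR_gt0 theta (c0 m))).
  by rewrite (le_trans (xa m)) ?a0.
move: b0; rewrite le_eqVlt => /predU1P[b0|b0].
  apply: allz => m; rewrite -(pmulr_rle0 _ (powR_gt0 (- (1 - theta)) (c0 m.+1))).
  by rewrite (le_trans (xb m)) ?b0.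
set P := a `^ (1 - theta) * b `^ theta.
have P0 : 0 < P by rewrite mulr_gt0 ?powR_gt0.
pose z := r * b / a; have z0 : 0 < z by rewrite divr_gt0 ?mulr_gt0.
have zE (m : nat) : r * 2 ^+ m * b = z * 2 ^+ m * a.
  by rewrite /z; field; rewrite lt0r_neq0.
have w0 (m : nat) : 0 < z * 2 ^+ m by rewrite mulr_gt0 // exprn_gt0.
pose u := z `^ (- theta); pose v := z `^ (1 - theta).
pose q : R := 2 `^ (- theta); pose p : R := 2 `^ (1 - theta).
have powX e (m : nat) : (z * 2 ^+ m) `^ e = z `^ e * (2 `^ e) ^+ m.
  rewrite powRM ?(ltW z0) ?exprn_ge0 //; congr (_ * _).
  by rewrite -(powR_mulrn m (powR_ge0 2 e)) -(powR_mulrn m (ler0n _ 2)) powRAC.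
have xu (m : 'I_N) : x m <= P * (u * q ^+ m).
  rewrite -powX powRN ler_pdivlMr ?powR_gt0 //.
  rewrite -(ler_pM2l (powR_gt0 theta a0)) [leLHS]mulrCA [a `^ _ * _ as X in _ * X]mulrC.
  rewrite -powRM ?(ltW (w0 m)) ?(ltW a0) // -zE powRM ?(ltW (c0 m)) ?(ltW b0) //.
  have -> : a `^ theta * P = a * b `^ theta.
    by rewrite /P mulrA [a `^ theta * a `^ (1 - theta)]mulrC powR_complement powRr1 ?ltW.
  by rewrite mulrA [x m * _]mulrC; apply: (ler_wpM2r (powR_ge0 b theta)).
have xv (m : 'I_N) : x m <= P * (2 * (v * p ^+ m)).
  have := xb m; rewrite powRN mulrC ler_pdivrMr ?powR_gt0 // => /le_trans; apply.
  rewrite -[X in X * _](powRr1 (ltW b0)) -(powR_complement _ theta).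
  rewrite [leLHS]mulrAC -powRM ?(ltW b0) ?(ltW (c0 _)) // [b * _]mulrC zE.
  rewrite powRM ?(ltW a0) ?(ltW (w0 _)) // powX -/v -/p exprS.
  rewrite [leLHS](_ : _ = P * (p * (v * p ^+ m))); last by rewrite /P; ring.
  rewrite (ler_wpM2l (ltW P0)) // ler_wpM2r ?mulr_ge0 ?exprn_ge0 ?powR_ge0 //.
  by rewrite ler1_powR ?ler1n // gerBl ltW.
(* With t = z 2^m, one of t^(-theta) and t^(1-theta) is at most 1. The bound by that one survives
   truncation, and the other term only adds something nonnegative. *)
pose trunc (t : R) := if t <= 1 then t else 0.
have trunc0 t : 0 <= t -> 0 <= trunc t by rewrite /trunc; case: ifP.
have xm (m : 'I_N) : x m <= P * (trunc (u * q ^+ m) + 2 * trunc (v * p ^+ m)).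
  have uq0 : 0 <= u * q ^+ m by rewrite mulr_ge0 ?exprn_ge0 ?powR_ge0.
  have vp0 : 0 <= v * p ^+ m by rewrite mulr_ge0 ?exprn_ge0 ?powR_ge0.
  have [w1|w1] := leP 1 (z * 2 ^+ m).
    apply: le_trans (xu m) _; rewrite ler_pM2l // /trunc ifT ?lerDl ?mulr_ge0 ?trunc0 //.
    by rewrite -powX -[leRHS](powRr0 (z * 2 ^+ m)) ler_powR // oppr_le0 ltW.
  apply: le_trans (xv m) _; rewrite ler_pM2l // /trunc ler_wpDl ?trunc0 // ifT //.
  by rewrite -powX -[leRHS](powRr0 (z * 2 ^+ m)) ger_powR // ?w0 ltW.
rewrite (le_trans (ler_sum _ (fun m _ => xm m))) // -mulr_sumr mulrC ler_pM2r //.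
rewrite big_split /= -mulr_sumr /trunc lerD // ?ler_wpM2l //.
  exact: truncated_geom_decreasing (powR_ge0 _ _) (powR2N_lt1 th0).
exact: truncated_geom_increasing (powR_ge0 _ _) (powR2_gt1 th1').
Qed.

End PowerInequalities.

(** * Linear operators on a domain of sequences, and averaging over signs *)

Section LinearOperators.
Variables (R : realType) (D : set (int -> R[i])).
Variable T : (int -> R[i]) -> (int -> R[i]).
Implicit Types (f g : int -> R[i]) (a : R[i]).

Definition linear_domain := D (fun=> 0) /\
  forall a f g, D f -> D g -> D (fun n => a * f n + g n).

Hypothesis hD : linear_domain.
Hypothesis hT : forall a f g, D f -> D g ->
  T (fun n => a * f n + g n) = (fun n => a * T f n + T g n).

Lemma linear_operator0 : T (fun=> 0) = (fun=> 0).
Proof.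
have := hT (-1) hD.1 hD.1; under eq_fun do rewrite mulr0 addr0.
by move=> ->; apply/funext => n; rewrite mulN1r addNr.
Qed.

Lemma domain_scale a f : D f -> D (fun n => a * f n).
Proof.
move=> Df; have := hD.2 a f _ Df hD.1.
by under eq_fun do rewrite addr0.
Qed.

Lemma operator_scale a f : D f -> T (fun n => a * f n) = (fun n => a * T f n).
Proof.
move=> Df; have := hT a Df hD.1; under eq_fun do rewrite addr0.
by move=> ->; rewrite linear_operator0; apply/funext => n; rewrite addr0.
Qed.

Lemma domain_sub f g : D f -> D g -> D (fun n => f n - g n).
Proof.
move=> Df Dg; have := hD.2 (-1) _ _ Dg Df.
by under eq_fun do rewrite mulN1r addrC.
Qed.

Lemma operator_sub f g : D f -> D g ->
  T (fun n => f n - g n) = (fun n => T f n - T g n).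
Proof.
move=> Df Dg; have := hT (-1) Dg Df; under eq_fun do rewrite mulN1r addrC.
by move=> ->; apply/funext => n; rewrite mulN1r addrC.
Qed.

Lemma operator_sum (I : Type) (s : seq I) (c : I -> R[i])
    (F : I -> int -> R[i]) : (forall i, D (F i)) ->
  D (fun n => \sum_(i <- s) c i * F i n) /\
  T (fun n => \sum_(i <- s) c i * F i n) =
    (fun n => \sum_(i <- s) c i * T (F i) n).
Proof.
move=> DF; elim: s => [|i s [ihD ihT]].
  under eq_fun do rewrite big_nil.
  split; first exact: hD.1.
  by rewrite linear_operator0; apply/funext => n; rewrite big_nil.
under eq_fun do rewrite big_cons.
split; first exact: hD.2.
by rewrite hT // ihT; apply/funext => n; rewrite big_cons.
Qed.

(** Boundedness as a statement about modular unit balls, the form in which Jensen's inequality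
    applies directly to the values of [T f]. *)
Definition modular_bounded (Y : R -> R) (M : R) := forall f,
  sums_le (fun n => Y (modulus (f n))) 1 ->
  D f /\ sums_le (fun n => Y (modulus (T f n) / M)) 1.

(* Averaging over all choices of signs replaces the triangle inequality, which
   would lose a factor N. *)
Lemma signed_pieces_bound (Y : R -> R) (M : R) (g : int -> R) N
    (F : 'I_N -> int -> R[i]) : young Y -> 0 < M -> modular_bounded Y M ->
  (forall m, D (F m)) -> (forall n, \sum_m modulus (F m n) <= g n) ->
  sums_le (fun n => Y (g n)) 1 ->
  exists h : int -> R, [/\ forall n, 0 <= h n,
    sums_le (fun n => Y (h n / M)) 1 &
    forall m n, modulus (T (F m) n) <= h n].
Proof.
move=> yY M0 bY DF Fg hg.
pose E := {ffun 'I_N -> bool}.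
pose S (e : E) n := \sum_m (-1) ^+ e m * F m n : R[i].
have hS e : T (S e) = fun n => \sum_m (-1) ^+ e m * T (F m) n.
  by rewrite (operator_sum (index_enum 'I_N) (fun m => (-1) ^+ e m) DF).2.
have Sle e : sums_le (fun n => Y (modulus (S e n))) 1.
  apply: sums_le_mono hg => n; apply: (young_le yY); first exact: modulus_ge0.
  apply: le_trans (modulus_sum _ _ _) _; apply: le_trans (Fg n).
  by apply: ler_sum => m _; rewrite modulus_sign.
have card0 : 0 < #|{: E}|%:R :> R.
  by rewrite ltr0n; apply/card_gt0P; exists [ffun=> true].
exists (fun n => (\sum_e modulus (T (S e) n)) / #|{: E}|%:R); split.
- by move=> n; rewrite divr_ge0 ?ler0n // sumr_ge0 // => e _; exact: modulus_ge0.
- have := sums_leZ (_ : 0 <= #|{: E}|%:R^-1) (sums_le_sum (fun e => (bY _ (Sle e)).2)).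
  rewrite mulr1 mulVf ?gt_eqF // => /(_ (ltac:(by rewrite invr_ge0 ltW))).
  apply: sums_le_mono => n; rewrite mulrAC mulr_suml [leRHS]mulrC.
  apply: young_average => // e; rewrite divr_ge0 ?modulus_ge0 // ltW //.
- move=> m n; rewrite (le_trans (sign_average (fun m => T (F m) n) m)) //.
  rewrite le_eqVlt; apply/orP; left; apply/eqP; congr (_ / _).
  by apply: eq_bigr => e _; rewrite hS.
Qed.

(** A single term of a modular is at most 1, so membership in the unit ball bounds every coordinate.
    Applied to [c] times [f], this makes the image of a tail uniformly small when [c] is large. *)
Lemma modular_bounded_decay (Y : R -> R) (M u c : R) (g : int -> R) f :
  young Y -> 0 < M -> 0 < c -> modular_bounded Y M ->
  (forall x, 0 <= x -> Y x <= 1 -> x <= u) ->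
  (forall n, c * modulus (f n) <= g n) -> sums_le (fun n => Y (g n)) 1 ->
  D f /\ forall n, modulus (T f n) <= M * u / c.
Proof.
move=> yY M0 c0 bY hu fg hg.
pose F n := (c%:C)%C * f n.
have [|DF hTF] := bY F.
  apply: sums_le_mono hg => n; apply: (young_le yY); first exact: modulus_ge0.
  by rewrite /F modulusM modulus_real gtr0_norm.
have cne : (c%:C)%C != 0 :> R[i] by rewrite fmorph_eq0 gt_eqF.
have Df : D f.
  have := domain_scale ((c%:C)%C)^-1 DF; rewrite /F.
  by under eq_fun do rewrite mulKf //.
split=> // n; have := sums_le_single n hTF; rewrite operator_scale //.
rewrite modulusM modulus_real gtr0_norm // => /hu h.
rewrite ler_pdivlMr // mulrC [M * u]mulrC -ler_pdivrMr // h //.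
by rewrite divr_ge0 ?mulr_ge0 ?modulus_ge0 // ltW.
Qed.

End LinearOperators.

(** * Dyadic decomposition of a sequence along the ratio g0/g1 *)

Section Cuts.
Variables (R : realType) (theta : R) (f : int -> R[i]) (g0 g1 : int -> R).
Hypothesis theta01 : 0 < theta < 1.
Hypothesis g0_ge0 : forall n, 0 <= g0 n.
Hypothesis g1_ge0 : forall n, 0 <= g1 n.
Hypothesis f_le : forall n,
  modulus (f n) <= g0 n `^ (1 - theta) * g1 n `^ theta.

(** The part of [f] where g0/g1 is at least [c], written without a quotient because [g1] may
    vanish. *)
Definition ratio_cut (c : R) : int -> R[i] := fun n =>
  if c * g1 n <= g0 n then f n else 0.

Lemma ratio_cut_bound c n : 0 < c -> c `^ theta * modulus (ratio_cut c n) <= g0 n.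
Proof.
move=> c0; rewrite /ratio_cut; case: ifPn => h; last by rewrite modulus0 mulr0.
exact: (le_product_high theta01 (g0_ge0 n) (g1_ge0 n) c0 (f_le n) h).
Qed.

Lemma ratio_cut_complement_bound c n : 0 < c ->
  c `^ (- (1 - theta)) * modulus (f n - ratio_cut c n) <= g1 n.
Proof.
move=> c0; rewrite /ratio_cut; case: ifPn => h.
  by rewrite subrr modulus0 mulr0.
rewrite subr0; apply: (le_product_low theta01 (g0_ge0 n) (g1_ge0 n) c0 (f_le n)).
by rewrite ltW // ltNge.
Qed.

(** As differences of cuts the pieces telescope and inherit membership in the domain; [pieceE] gives
    the dyadic band. *)
Definition piece (r : R) (m : nat) : int -> R[i] :=
  fun n => ratio_cut (r * 2 ^+ m) n - ratio_cut (r * 2 ^+ m.+1) n.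

Lemma pieceE r m n : 0 < r -> piece r m n =
  if r * 2 ^+ m * g1 n <= g0 n < r * 2 ^+ m.+1 * g1 n then f n else 0.
Proof.
move=> r0; rewrite /piece /ratio_cut ltNge.
case: ifPn => h1; case: ifPn => h2 /=; rewrite ?subrr ?subr0 //.
exfalso; move/negP: h1; apply; apply: le_trans h2.
by rewrite ler_wpM2r // ler_pM2l // ler_eXn2l ?ler1n // ltr1n.
Qed.

(** The bands are disjoint, so for fixed [n] at most one summand is nonzero, whatever the
    weights. *)
Lemma weighted_pieces_bound r N (w : nat -> R) (g : int -> R) n : 0 < r ->
  0 <= g n ->
  (forall m, r * 2 ^+ m * g1 n <= g0 n < r * 2 ^+ m.+1 * g1 n ->
     w m * modulus (f n) <= g n) ->
  \sum_(m < N) w m * modulus (piece r m n) <= g n.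
Proof.
move=> r0 g_ge0 hw.
pose P (m : 'I_N) := r * 2 ^+ m * g1 n <= g0 n < r * 2 ^+ m.+1 * g1 n.
have [m Pm|noP] := pickP P; last first.
  by rewrite big1 // => m _; rewrite pieceE // -/(P m) noP modulus0 mulr0.
rewrite (bigD1 m) //= big1 => [|k km].
  by rewrite addr0 pieceE // -/(P m) Pm; exact: hw.
rewrite pieceE // -/(P k); case: ifPn => [Pk|]; last by rewrite modulus0 mulr0.
exfalso; move: Pm Pk => /andP[a1 a2] /andP[b1 b2].
have mono i j : (i <= j)%N -> r * 2 ^+ i * g1 n <= r * 2 ^+ j * g1 n.
  by move=> ij; rewrite ler_wpM2r // ler_pM2l // ler_eXn2l // ltr1n.
have [mk|] := ltnP m k; first by have := mono _ _ mk; lra.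
rewrite leq_eqVlt => /predU1P[kE|kmlt]; last by have := mono _ _ kmlt; lra.
by move/eqP: km; apply; apply: val_inj.
Qed.

End Cuts.

Section Scales.
Variable R : realType.

Lemma small_scale (A e eps : R) : 0 <= A -> 0 < e -> 0 < eps ->
  exists2 r : R, 0 < r & A * r `^ e <= eps.
Proof.
move=> A0 e0 eps0; have A1 : 0 < A + 1 by rewrite ltr_wpDl.
exists ((eps / (A + 1)) `^ e^-1); first by rewrite powR_gt0 ?divr_gt0.
rewrite -powRrM mulVf ?gt_eqF // powRr1 ?divr_ge0 ?(ltW eps0) ?(ltW A1) //.
by rewrite mulrCA ger_pMr // ler_pdivrMr // mul1r; lra.
Qed.

(** The lowest cut [r] is chosen freely, but the highest one must lie on the grid [r * 2 ^+ N] for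
    the pieces to telescope. *)
Lemma large_scale (A e eps r : R) : 0 <= A -> 0 < e -> 0 < eps -> 0 < r ->
  exists N : nat, A / (r * 2 ^+ N) `^ e <= eps.
Proof.
move=> A0 e0 eps0 r0; have [d d0 Ad] := small_scale A0 e0 eps0.
have [N hN] : exists N : nat, (r * d)^-1 <= 2 ^+ N.
  have x0 : 0 <= (r * d)^-1 by rewrite invr_ge0 mulr_ge0 ?ltW.
  exists (Num.bound (r * d)^-1); rewrite ltW // (lt_trans (archi_boundP x0)) //.
  by rewrite -natrX ltr_nat ltn_expl.
exists N; apply: le_trans Ad; rewrite ler_wpM2l // -powRN.
have c0 : 0 < r * 2 ^+ N by rewrite mulr_gt0 // exprn_gt0.
rewrite -[- e]mulN1r powRrM powR_inv1 ?(ltW c0) //.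
rewrite ge0_ler_powR ?(ltW e0) // ?nnegrE ?invr_ge0 ?(ltW c0) ?(ltW d0) //.
rewrite invf_ple ?posrE //; move: hN.
by rewrite invfM -ler_pdivrMl ?invr_gt0 // invrK mulrA mulfV ?gt_eqF // mul1r.
Qed.

End Scales.

(** * Pointwise interpolation bound for [T f] *)

Section Interpolation.
Variables (R : realType) (D : set (int -> R[i])).
Variable T : (int -> R[i]) -> (int -> R[i]).
Hypothesis hD : linear_domain D.
Hypothesis hT : forall a f g, D f -> D g ->
  T (fun n => a * f n + g n) = (fun n => a * T f n + T g n).
Variables (Y0 Y1 : R -> R) (M0 M1 u0 u1 theta : R).
Hypotheses (yY0 : young Y0) (yY1 : young Y1) (M0_gt0 : 0 < M0) (M1_gt0 : 0 < M1).
Hypotheses (bY0 : modular_bounded D T Y0 M0) (bY1 : modular_bounded D T Y1 M1).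
Hypothesis hu0 : forall x, 0 <= x -> Y0 x <= 1 -> x <= u0.
Hypothesis hu1 : forall x, 0 <= x -> Y1 x <= 1 -> x <= u1.
Hypothesis theta01 : 0 < theta < 1.

(** The majorants [h0], [h1] depend on [eps] through the number of pieces, but the bounds on their
    modulars and the constant do not. *)
Lemma calderon_interpolation (f : int -> R[i]) (g0 g1 : int -> R) :
  (forall n, 0 <= g0 n) -> (forall n, 0 <= g1 n) ->
  (forall n, modulus (f n) <= g0 n `^ (1 - theta) * g1 n `^ theta) ->
  sums_le (fun n => Y0 (g0 n)) 1 -> sums_le (fun n => Y1 (g1 n)) 1 ->
  D f /\ forall eps, 0 < eps -> exists h0 h1 : int -> R,
    [/\ forall n, 0 <= h0 n, forall n, 0 <= h1 n,
        sums_le (fun n => Y0 (h0 n / M0)) 1, sums_le (fun n => Y1 (h1 n / M1)) 1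
      & forall n, modulus (T f n) <= eps +
          calderon_constant theta * (h0 n `^ (1 - theta) * h1 n `^ theta)].
Proof.
move=> g0_ge0 g1_ge0 fle hg0 hg1; have /andP[th0 th1] := theta01.
have th1' : 0 < 1 - theta by rewrite subr_gt0.
pose C := ratio_cut f g0 g1.
have hC c : 0 < c -> D (C c) /\ forall n, modulus (T (C c) n) <= M0 * u0 / c `^ theta.
  move=> c0; apply: (modular_bounded_decay hD hT yY0 M0_gt0 _ bY0 hu0 _ hg0).
    exact: powR_gt0.
  by move=> n; exact: ratio_cut_bound.
have hCc c : 0 < c -> D (fun n => f n - C c n) /\
    forall n, modulus (T (fun n => f n - C c n) n) <= M1 * u1 / c `^ (- (1 - theta)).
  move=> c0; apply: (modular_bounded_decay hD hT yY1 M1_gt0 _ bY1 hu1 _ hg1).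
    exact: powR_gt0.
  by move=> n; apply: ratio_cut_complement_bound.
have Df : D f.
  have := hD.2 1 _ _ (hC 1 ltr01).1 (hCc 1 ltr01).1.
  by under eq_fun do rewrite mul1r addrC subrK.
split=> // eps eps0.
have eps2 : 0 < eps / 2 by rewrite divr_gt0.
have u0_ge0 : 0 <= u0 by apply: hu0 => //; rewrite (young0 yY0).
have u1_ge0 : 0 <= u1 by apply: hu1 => //; rewrite (young0 yY1).
(* [r] makes the image of the tail below the lowest band at most eps/2, and [N] does the same above
   the highest band. *)
have [r r0 hr] := small_scale (mulr_ge0 (ltW M1_gt0) u1_ge0) th1' eps2.
have [N hN] := large_scale (mulr_ge0 (ltW M0_gt0) u0_ge0) th0 eps2 r0.
have c0 (m : nat) : 0 < r * 2 ^+ m by rewrite mulr_gt0 // exprn_gt0.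
pose p := piece f g0 g1 r.
have Dp m : D (p m) by apply: domain_sub => //; exact: (hC _ (c0 _)).1.
have pieces w Y M g : young Y -> 0 < M -> modular_bounded D T Y M ->
    (forall m, 0 < w m) -> (forall n, 0 <= g n) ->
    (forall m n, r * 2 ^+ m * g1 n <= g0 n < r * 2 ^+ m.+1 * g1 n ->
      w m * modulus (f n) <= g n) ->
    sums_le (fun n => Y (g n)) 1 ->
    exists h : int -> R, [/\ forall n, 0 <= h n,
      sums_le (fun n => Y (h n / M)) 1 &
      forall (m : 'I_N) n, w m * modulus (T (p m) n) <= h n].
  move=> yY M0' bY w0 g_ge0 hw hg.
  pose F (m : 'I_N) n := ((w m)%:C)%C * p m n.
  have [||h [h0 hh hTh]] := @signed_pieces_bound _ _ _ hD hT _ _ g _ F yY M0' bY _ _ hg.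
  - by move=> m; exact: domain_scale.
  - move=> n; rewrite (eq_bigr (fun m : 'I_N => w m * modulus (p m n))).
      by apply: weighted_pieces_bound => // m; exact: hw.
    by move=> m _; rewrite /F modulusM modulus_real gtr0_norm.
  exists h; split=> // m n; have := hTh m n.
  by rewrite /F (operator_scale hD hT) // modulusM modulus_real gtr0_norm.
have [|//|m n /andP[h _]|h0 [h0_ge0 hh0 Th0]] :=
    pieces (fun m => (r * 2 ^+ m) `^ theta) _ _ g0 yY0 M0_gt0 bY0 _ _ _ hg0.
- by move=> m; exact: powR_gt0.
- exact: (le_product_high theta01 (g0_ge0 n) (g1_ge0 n) (c0 m) (fle n) h).
(* On a band the lower end point governs the bound by [g0] and the upper one the bound by [g1],
   hence [m] above and [m.+1] here. *)
have [|//|m n /andP[_ h]|h1 [h1_ge0 hh1 Th1]] :=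
    pieces (fun m => (r * 2 ^+ m.+1) `^ (- (1 - theta))) _ _ g1 yY1 M1_gt0 bY1 _ _ _ hg1.
- by move=> m; exact: powR_gt0.
- exact: (le_product_low theta01 (g0_ge0 n) (g1_ge0 n) (c0 _) (fle n) (ltW h)).
exists h0, h1; split => // n.
have [DCr _] := hC r r0; have [DCN TCN] := hC _ (c0 N).
have [DCr' TCr'] := hCc r r0.
have Tsum : \sum_(m < N) T (p m) n = T (C r) n - T (C (r * 2 ^+ N)) n.
  rewrite /p /piece -/C; elim: (N) => [|k ih].
    by rewrite big_ord0 expr0 mulr1 subrr.
  rewrite big_ord_recr /= ih (operator_sub hT (hC _ (c0 _)).1 (hC _ (c0 _)).1).
  by rewrite addrA subrK.
(* High tail, low tail and the bands between them; the two tails take eps/2 each. *)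
have -> : T f n = T (C (r * 2 ^+ N)) n + T (fun n => f n - C r n) n +
    \sum_(m < N) T (p m) n.
  by rewrite Tsum (operator_sub hT Df DCr); ring.
apply: le_trans (modulusD _ _) _; apply: lerD.
  apply: le_trans (modulusD _ _) _; rewrite [eps]splitr lerD //.
    exact: le_trans (TCN n) hN.
  by apply: le_trans (TCr' n) _; rewrite powRN invrK.
apply: le_trans (modulus_sum _ _ _) _.
apply: (calderon_sum theta01 (h0_ge0 n) (h1_ge0 n) r0) => m.
- exact: modulus_ge0.
- exact: Th0.
- exact: Th1.
Qed.

End Interpolation.

(** * Increasing bijections of the half line and N-functions *)

Section HalfLineBijections.
Variable R : realType.
Implicit Types (F Phi : R -> R).

(** An increasing homeomorphism of the half line in purely order-theoretic terms, which makes
    [inverse_half_line] a true two-sided inverse. *)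
Record half_line_bijection F : Prop := {
  hlb_ge0 : forall t, 0 <= t -> 0 <= F t ;
  hlb_lt : forall s t, 0 <= s -> s < t -> F s < F t ;
  hlb_surj : forall y, 0 <= y -> exists2 x, 0 <= x & F x = y
}.

Variable F : R -> R.
Hypothesis hF : half_line_bijection F.
Local Notation G := (inverse_half_line F).

Lemma hlb_le s t : 0 <= s -> s <= t -> F s <= F t.
Proof.
by move=> s0; rewrite le_eqVlt => /predU1P[->//|/(hlb_lt hF s0)/ltW].
Qed.

Lemma hlb_le_reflect s t : 0 <= t -> F s <= F t -> s <= t.
Proof. by move=> t0; rewrite !leNgt; apply: contra => /(hlb_lt hF t0). Qed.

Lemma hlb0 : F 0 = 0.
Proof.
have [x x0 Fx] := hlb_surj hF (lexx 0).
by apply/eqP; rewrite eq_le hlb_ge0 // -{2}Fx hlb_le.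
Qed.

Lemma hlb_inverse : (forall x, 0 <= x -> G (F x) = x) /\
  (forall y, 0 <= y -> F (G y) = y).
Proof.
have inj : {in `[0, +oo[%classic &, injective F}.
  move=> s t; rewrite !inE /= !in_itv /= !andbT => s0 t0 e.
  by apply: le_anti; apply/andP; split; apply: hlb_le_reflect; rewrite // e.
have GF x : 0 <= x -> G (F x) = x.
  by move=> x0; apply: (pinvKV _ inj); rewrite inE /= in_itv /= x0.
by split=> // y /(hlb_surj hF)[x x0 <-]; rewrite GF.
Qed.

Lemma hlb_inverse_ge0 y : 0 <= y -> 0 <= G y.
Proof. by move=> /(hlb_surj hF)[x x0 <-]; rewrite hlb_inverse.1. Qed.

Lemma hlb_inverse_le x y : 0 <= x -> x <= y -> G x <= G y.
Proof.
move=> x0 xy; have y0 := le_trans x0 xy.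
by apply: hlb_le_reflect; rewrite ?hlb_inverse_ge0 // !hlb_inverse.2.
Qed.

Lemma hlb_inverse_gt0 y : 0 < y -> 0 < G y.
Proof.
move=> y0; rewrite lt_neqAle hlb_inverse_ge0 ?ltW // andbT.
apply/eqP => e; have := hlb_inverse.2 _ (ltW y0).
by rewrite -e hlb0 => y0'; rewrite -y0' ltxx in y0.
Qed.

(** The inverse of an increasing concave bijection is convex: compare the two sides after applying
    [F]. *)
Lemma inverse_young :
  (forall p x y, 0 <= p <= 1 -> 0 <= x -> 0 <= y ->
    p * F x + (1 - p) * F y <= F (p * x + (1 - p) * y)) ->
  young G.
Proof.
move=> cF; have [GF FG] := hlb_inverse.
have p1 (p : R) : 0 <= p <= 1 -> 0 <= p /\ 0 <= 1 - p.
  by move=> /andP[-> ?]; rewrite subr_ge0.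
split; [exact: hlb_inverse_ge0|exact: hlb_inverse_le| |].
  by rewrite -[X in G X]hlb0 GF.
move=> p x y /[dup] /p1 [p0 q0] p01 x0 y0.
have Gx := hlb_inverse_ge0 x0; have Gy := hlb_inverse_ge0 y0.
apply: hlb_le_reflect; first by rewrite addr_ge0 // mulr_ge0.
rewrite FG; last by rewrite addr_ge0 // mulr_ge0.
by apply: le_trans (cF _ _ _ p01 Gx Gy); rewrite !FG.
Qed.

End HalfLineBijections.

Section NFunctions.
Variables (R : realType) (Phi : R -> R).
Hypothesis hPhi : N_function Phi.

Lemma N_function_young : young Phi.
Proof.
split; [exact: N_function_ge0 hPhi| |exact/(N_function_eq0 hPhi)|].
  move=> x y x0; rewrite le_eqVlt => /predU1P[->//|xy].
  apply/ltW/(N_function_increasing hPhi) => //.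
    by rewrite in_itv /= x0.
  by rewrite in_itv /= (le_trans x0) // ltW.
move=> p x y /andP[p0 p1] x0 y0.
have := N_function_convex hPhi (Itv01 p0 p1) (x := x) (y := y).
rewrite !inE /= !in_itv /= x0 y0 => /(_ isT isT).
by rewrite !convRE /=.
Qed.

Lemma N_function_bijection : half_line_bijection Phi.
Proof.
split; first exact: N_function_ge0 hPhi.
  move=> s t s0 st; apply: (N_function_increasing hPhi) => //.
    by rewrite in_itv /= s0.
  by rewrite in_itv /= (le_trans s0) // ltW.
move=> y y0; have Phi0 : Phi 0 = 0 by apply/(N_function_eq0 hPhi).
have /cvgryPge/(_ y)[A [_ hA]] := N_function_infty hPhi.
(* Beyond [A] the quotient [Phi b / b] is at least [y], and [1 <= b] then gives [y <= Phi b] for the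
   intermediate value theorem. *)
pose b := Num.max 1 (A + 1).
have b1 : 1 <= b by rewrite le_max lexx.
have b0 : 0 < b by rewrite (lt_le_trans ltr01).
have yb : y <= Phi b.
  have : y <= Phi b / b by apply: hA; rewrite lt_max ltrDl ltr01 orbT.
  rewrite ler_pdivlMr //; apply: le_trans; exact: ler_peMr.
have cont : {within `[0, b], continuous Phi}.
  apply: continuous_subspaceW (N_function_continuous hPhi).
  by move=> x /=; rewrite !in_itv /= => /andP[->].
have [|c] := @IVT _ Phi 0 b y (ltW b0) cont.
  by rewrite Phi0 ge_min y0 /= le_max yb orbT.
by rewrite in_itv /= => /andP[c0 _] <-; exists c.
Qed.

End NFunctions.

(** * Least concave majorant of an almost quasi-concave function *)

Section ConcaveMajorant.
Variables (R : realType) (Psi : R -> R) (K : R).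
Hypothesis Psi0 : Psi 0 = 0.
Hypothesis Psi_gt0 : forall t, 0 < t -> 0 < Psi t.
Hypothesis K0 : 0 < K.
Hypothesis Psi_le : forall s t, 0 < s -> 0 < t -> Psi s <= K * (1 + s / t) * Psi t.
Hypothesis Psi_unbounded : forall A, exists2 t, 0 < t & A <= Psi t.
Hypothesis Psi_small : forall eps, 0 < eps -> exists2 t, 0 < t & Psi t <= eps.
Local Notation m := (least_concave_majorant Psi).

Lemma concave_functionP (F : R -> R) :
  convex_function (`[0, +oo[ : set R^o) ((fun t => - F t) : R^o -> R^o) <->
  forall p x y, 0 <= p <= 1 -> 0 <= x -> 0 <= y ->
    p * F x + (1 - p) * F y <= F (p * x + (1 - p) * y).
Proof.
split=> [h p x y /andP[p0 p1] x0 y0|h p x y].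
  have := h (Itv01 p0 p1) x y; rewrite !inE /= !in_itv /= x0 y0 => /(_ isT isT).
  by rewrite !convRE /= /unstable.onem; lra.
rewrite !inE /= !in_itv /= !andbT => x0 y0.
have := h p%:num x y; rewrite ge0 le1 => /(_ isT x0 y0).
by rewrite !convRE /= /unstable.onem; lra.
Qed.

(* The class of majorants requires F 0 = 0; dropping an affine function to 0 at
   the end point keeps it concave. *)
Lemma affine_majorant t : 0 < t ->
  concave_above Psi (fun s => if s == 0 then 0 else K * (1 + s / t) * Psi t).
Proof.
move=> t0; set A := fun s => K * (1 + s / t) * Psi t.
have A0 s : 0 <= s -> 0 < A s.
  move=> s0; rewrite !mulr_gt0 ?Psi_gt0 // ltr_pwDl // divr_ge0 // ltW //.
split.
- by move=> s s0; case: ifP => // _; exact/ltW/A0.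
- apply/concave_functionP => p x y /andP[p0 p1] x0 y0.
  have q0 : 0 <= 1 - p by rewrite subr_ge0.
  have AE : A (p * x + (1 - p) * y) = p * A x + (1 - p) * A y by rewrite /A; ring.
  have Ax := ltW (A0 _ x0); have Ay := ltW (A0 _ y0).
  have le_A z : 0 <= z -> (if z == 0 then 0 else A z) <= A z.
    by move=> z0; case: ifP => // _; exact/ltW/A0.
  (* At the modified end point both [p * x] and [(1 - p) * y] vanish, so each term on the left has a
     zero weight or the value at 0. *)
  rewrite /=; have [/eqP z_eq|z_neq] := boolP (p * x + (1 - p) * y == 0); last first.
    apply: (@le_trans _ _ (p * A x + (1 - p) * A y)).
      by rewrite lerD // ler_wpM2l // le_A.
    by rewrite -AE.
  move: z_eq.
  have [x_eq|x_neq] := eqVneq x 0.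
    rewrite x_eq !mulr0 !add0r => /eqP; rewrite mulf_eq0 => /orP[/eqP ->|/eqP ->].
      by rewrite mul0r.
    by rewrite eqxx mulr0.
  have [y_eq|y_neq] := eqVneq y 0.
    rewrite y_eq !mulr0 !addr0 => /eqP; rewrite mulf_eq0 (negbTE x_neq) orbF.
    by move=> /eqP ->; rewrite mul0r.
  move=> /eqP; rewrite paddr_eq0 ?mulr_ge0 // !mulf_eq0.
  rewrite (negbTE x_neq) (negbTE y_neq) !orbF.
  by move=> /andP[/eqP -> /eqP ->]; rewrite !mul0r addr0.
- move=> s s0; have := A0 _ s0; rewrite /A; case: eqVneq => [->//|sn] As.
  by split => [e|/eqP]; [rewrite e ltxx in As|rewrite (negbTE sn)].
- move=> s; rewrite le_eqVlt => /predU1P[<-|s0]; first by rewrite eqxx Psi0.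
  by rewrite gt_eqF //; exact: Psi_le.
Qed.

Lemma majorant_has_lbound t : 0 <= t ->
  has_lbound [set F t | F in concave_above Psi].
Proof. by move=> t0; exists 0 => _ [F [h _ _ _] <-]; exact: h. Qed.

Lemma majorant_nonempty t : [set F t | F in concave_above Psi] !=set0.
Proof.
by eexists; exists (fun s => if s == 0 then 0 else K * (1 + s / 1) * Psi 1) => //;
  exact: affine_majorant.
Qed.

Lemma majorant_le F t : 0 <= t -> concave_above Psi F -> m t <= F t.
Proof. by move=> t0 hF; apply: ge_inf; [exact: majorant_has_lbound|exists F]. Qed.

Lemma majorant_above t : 0 <= t -> Psi t <= m t.
Proof.
move=> t0; apply: lb_le_inf; first exact: majorant_nonempty.
by move=> _ [F [_ _ _ h] <-]; exact: h.
Qed.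

(** The affine majorant attached to [t] is evaluated at [t] itself, where 1 + s/t equals 2. *)
Lemma majorant_le_Psi t : 0 < t -> m t <= 2 * K * Psi t.
Proof.
move=> t0; apply: le_trans (majorant_le (ltW t0) (affine_majorant t0)) _.
by rewrite gt_eqF // divff ?gt_eqF // [2 * K]mulrC.
Qed.

Lemma majorant0 : m 0 = 0.
Proof.
apply: le_anti; apply/andP; split; last first.
  by have := majorant_above (lexx 0); rewrite Psi0.
by have := majorant_le (lexx 0) (affine_majorant ltr01); rewrite eqxx.
Qed.

Lemma majorant_concave p x y : 0 <= p <= 1 -> 0 <= x -> 0 <= y ->
  p * m x + (1 - p) * m y <= m (p * x + (1 - p) * y).
Proof.
move=> p01 x0 y0; apply: lb_le_inf; first exact: majorant_nonempty.
move=> _ [F hF <-]; have [_ /concave_functionP cF _ _] := hF.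
apply: le_trans (cF p x y p01 x0 y0); case/andP: p01 => p0 p1.
by rewrite lerD // ler_wpM2l ?majorant_le // subr_ge0.
Qed.

(** Concavity and unboundedness: [t] lies between [s] and some [u] with [m s < m u], and the graph
    is above the chord. *)
Lemma majorant_lt s t : 0 <= s -> s < t -> m s < m t.
Proof.
move=> s0 st; have t0 : 0 < t by rewrite (le_lt_trans s0).
(* The first summand bounds [Psi] up to [t] and so forces [t < u]; the other two force
   [m s < m u]. *)
have [u u0 hu] := Psi_unbounded (K * (1 + t / 1) * Psi 1 + m s + 1).
have ms0 : 0 <= m s by rewrite (le_trans _ (majorant_above s0)) //;
  move: s0; rewrite le_eqVlt => /predU1P[<-|/Psi_gt0/ltW//]; rewrite Psi0.
have Q0 : 0 <= K * (1 + t / 1) * Psi 1.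
  by rewrite !mulr_ge0 ?(ltW K0) ?(ltW (Psi_gt0 ltr01)) // divr1; lra.
have msu : m s < m u by have := majorant_above (ltW u0); lra.
have tu : t < u.
  rewrite ltNge; apply/negP => ut; have := Psi_le u0 ltr01.
  have : K * (1 + u / 1) * Psi 1 <= K * (1 + t / 1) * Psi 1.
    by rewrite ler_pM2r ?Psi_gt0 // ler_pM2l // !divr1 lerD2l.
  lra.
pose p := (u - t) / (u - s).
have us : 0 < u - s by lra.
have p1 : 1 - p = (t - s) / (u - s) by rewrite /p; field; rewrite gt_eqF.
have q0 : 0 < 1 - p by rewrite p1 divr_gt0 // subr_gt0.
have p0 : 0 <= p by rewrite /p divr_ge0 // ltW // subr_gt0.
have p01 : 0 <= p <= 1 by rewrite p0 -subr_ge0 ltW.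
have := majorant_concave p01 s0 (ltW u0).
have -> : p * s + (1 - p) * u = t by rewrite p1 /p; field; rewrite gt_eqF.
apply: lt_le_trans; have := mulr_gt0 q0 (_ : 0 < m u - m s).
by rewrite subr_gt0 => /(_ msu); lra.
Qed.

Lemma majorant_scale t l : 0 <= t -> 1 <= l -> m (l * t) <= l * m t.
Proof.
move=> t0 l1; have l0 : 0 < l by rewrite (lt_le_trans ltr01).
have p01 : 0 <= l^-1 <= 1 by rewrite invr_ge0 (ltW l0) invf_le1.
have := majorant_concave p01 (mulr_ge0 (ltW l0) t0) (lexx 0).
by rewrite majorant0 !mulr0 !addr0 mulKf ?gt_eqF // ler_pdivrMl.
Qed.

(** For surjectivity, [y] is attained at the supremum of the sublevel set of [y]. Instead of
    continuity, [majorant_scale] excludes both strict inequalities there: a factor [l > 1] could be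
    divided off the supremum or multiplied onto it. *)
Lemma majorant_bijection : half_line_bijection m.
Proof.
have m0 t : 0 <= t -> 0 <= m t.
  rewrite le_eqVlt => /predU1P[<-|t0]; first by rewrite majorant0.
  exact: le_trans (ltW (Psi_gt0 t0)) (majorant_above (ltW t0)).
split=> //; first by move=> s t; exact: majorant_lt.
move=> y; rewrite le_eqVlt => /predU1P[<-|y0]; first by exists 0; rewrite ?majorant0.
have [b b0 hb] := Psi_unbounded y.
have K2 : 0 < 2 * K by rewrite mulr_gt0.
have [a a0 ha] := Psi_small (divr_gt0 y0 K2).
have may : m a <= y.
  by rewrite (le_trans (majorant_le_Psi a0)) // mulrC -ler_pdivlMr.
have reflect s t : 0 <= t -> m s <= m t -> s <= t.
  by move=> t0; rewrite !leNgt; apply: contra; exact: majorant_lt.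
pose S := [set t | 0 <= t /\ m t <= y].
have Sa : S a by split => //; exact: ltW.
have Sb : has_ubound S.
  exists b => t [t0 mt]; apply: reflect; first exact: ltW.
  by rewrite (le_trans mt) // (le_trans hb) // majorant_above // ltW.
have s0 : 0 < sup S by rewrite (lt_le_trans a0) // ub_le_sup.
have ms0 : 0 < m (sup S) by have := majorant_lt (lexx 0) s0; rewrite majorant0.
exists (sup S); first exact: ltW.
apply/eqP; rewrite eq_le; apply/andP; split; rewrite leNgt; apply/negP => lty.
  pose l := m (sup S) / y.
  have l1 : 1 < l by rewrite ltr_pdivlMr // mul1r.
  have l0 := lt_trans ltr01 l1.
  have sl0 : 0 <= sup S / l by rewrite divr_ge0 // ltW.
  have hl : y <= m (sup S / l).
    have := majorant_scale sl0 (ltW l1).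
    rewrite mulrC divfK ?gt_eqF // /l mulrAC ler_pdivlMr // ler_pM2l //.
  have : sup S <= sup S / l.
    apply: ge_sup; first by exists a.
    by move=> t [t0 mt]; apply: reflect => //; exact: le_trans hl.
  by rewrite ler_pdivlMr // ger_pMr // leNgt l1.
pose l := y / m (sup S).
have l1 : 1 < l by rewrite ltr_pdivlMr // mul1r.
have : l * sup S <= sup S.
  apply: ub_le_sup => //; split; first by rewrite mulr_ge0 ?ltW // (lt_trans ltr01).
  rewrite (le_trans (majorant_scale (ltW s0) (ltW l1))) // /l divfK ?gt_eqF //.
by rewrite ger_pMl // leNgt l1.
Qed.

Lemma majorant_inverse_young : young (inverse_half_line m).
Proof. exact: inverse_young majorant_bijection majorant_concave. Qed.

End ConcaveMajorant.

(** * From the indices to power-type dilation bounds *)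

Section MatuszewskaOrliczIndices.
Variables (R : realType) (Phi : R -> R).
Hypothesis Phi_gt0 : forall u, 0 < u -> 0 < Phi u.

Lemma dilation_sup_ge t u : 0 < u ->
  ((Phi (t * u) / Phi u)%:E <= dilation_sup t Phi)%E.
Proof.
by move=> u0; apply: ereal_sup_ubound; exists u => //=; rewrite in_itv /= u0.
Qed.

Lemma dilation_le t c u : 0 < t -> 0 < u ->
  (lne (dilation_sup t Phi) < (c * ln t)%:E)%E -> Phi (t * u) <= t `^ c * Phi u.
Proof.
move=> t0 u0; have := dilation_sup_ge t u0; rewrite -ler_pdivrMr ?Phi_gt0 //.
case: (dilation_sup t Phi) => [r| |] //=.
  (* [lne] is -oo at nonpositive reals; there the bound holds because a power is nonnegative. *)
  rewrite lee_fin => hr; case: ifPn => [r0 _|].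
    by rewrite (le_trans hr) // (le_trans r0) // powR_ge0.
  rewrite -ltNge lte_fin => r0 h; rewrite (le_trans hr) //.
  have -> : t `^ c = expR (c * ln t) by rewrite /powR gt_eqF.
  by rewrite -[leLHS]lnK ?posrE // ler_expR ltW.
Qed.

(** A number below the supremum is exceeded at one [t], and multiplying by [ln t < 0] reverses the
    inequality. A single dilation factor suffices, since it is iterated later. *)
Lemma MO_alpha_dilation a : (a%:E < MO_alpha Phi)%E ->
  exists2 t, 0 < t < 1 & forall u, 0 < u -> Phi (t * u) <= t `^ a * Phi u.
Proof.
move=> /ereal_sup_gt[x [t /=]]; rewrite in_itv /= => t01 <- h.
exists t => // u u0; have /andP[t0 t1] := t01; apply: dilation_le => //.
have l0 : ln t < 0 by rewrite ln_lt0.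
move: h; case: (lne _) => [r| |] //.
- by rewrite -EFinM !lte_fin ltr_ndivlMr.
- by rewrite lt0_mulye // lte_fin invr_lt0.
- by rewrite ltNyr.
Qed.

Lemma MO_beta_dilation b : (MO_beta Phi < b%:E)%E ->
  exists2 t, 1 < t & forall u, 0 < u -> Phi (t * u) <= t `^ b * Phi u.
Proof.
move=> /ereal_inf_lt[x [t /=]]; rewrite in_itv /= andbT => t1 <- h.
have t0 : 0 < t by rewrite (lt_trans ltr01).
exists t => // u u0; apply: dilation_le => //.
have l0 : 0 < ln t by rewrite ln_gt0.
move: h; case: (lne _) => [r| |] //.
- by rewrite -EFinM !lte_fin ltr_pdivrMr.
- by rewrite gt0_mulye // lte_fin invr_gt0.
- by rewrite ltNyr.
Qed.

End MatuszewskaOrliczIndices.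

Section PowerGrowth.
Variable R : realType.
Implicit Types (G : R -> R) (p q s t e kappa : R).

Lemma expr_unbounded p A : 1 < p -> exists n : nat, A < p ^+ n.
Proof.
move=> p1; have d0 : 0 < p - 1 by rewrite subr_gt0.
have bernoulli n : 1 + n%:R * (p - 1) <= p ^+ n.
  elim: n => [|n ih]; first by rewrite mul0r addr0 expr0.
  rewrite exprS; have p0 : 0 <= p by lra.
  apply: le_trans (ler_wpM2l p0 ih); rewrite -natr1.
  have : 0 <= n%:R * (p - 1) * (p - 1) by rewrite !mulr_ge0 // ltW.
  nra.
exists (Num.bound (`|A| / (p - 1))).
have := archi_boundP (divr_ge0 (normr_ge0 A) (ltW d0)).
rewrite ltr_pdivrMr // => h.
apply: lt_le_trans (bernoulli _); apply: le_lt_trans (ler_norm A) _.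
by apply: (lt_trans h); rewrite ltrDr.
Qed.

(* [G t * t^-e] is almost increasing if it does not decrease along one
   geometric progression. *)
Lemma almost_increasing G p e : (forall s t, 0 <= s -> s <= t -> G s <= G t) ->
  (forall t, 0 <= t -> 0 <= G t) ->
  0 <= e -> 1 < p ->
  (forall y, 0 < y -> G y * y `^ (- e) <= G (p * y) * (p * y) `^ (- e)) ->
  forall s t, 0 < s -> s <= t ->
    G s * s `^ (- e) <= p `^ e * (G t * t `^ (- e)).
Proof.
move=> Gle G0 e0 p1 step s t s0 st; have p0 : 0 < p by rewrite (lt_trans ltr01).
have t0 := lt_le_trans s0 st.
have [n] := expr_unbounded (t / s) p1; rewrite ltr_pdivrMr // => hn.
elim: n s s0 st hn => [|n ih] s s0 st hn.
  by rewrite expr0 mul1r in hn; have := le_lt_trans st hn; rewrite ltxx.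
have [tps|pst] := ltP t (p * s); last first.
  apply: le_trans (step _ s0) _; apply: ih => //; first by rewrite mulr_gt0.
  by rewrite mulrA -exprSr.
rewrite mulrCA; apply: ler_pM; rewrite ?powR_ge0 ?G0 ?(ltW s0) //.
  by apply: Gle => //; exact: ltW.
rewrite !powRN ler_pdivlMr ?powR_gt0 // mulrC ler_pdivrMr ?powR_gt0 //.
rewrite -powRM ?(ltW p0) ?(ltW s0) // ge0_ler_powR // ?nnegrE ?ltW //.
by rewrite mulr_gt0.
Qed.

(** Downward version of [almost_increasing]: step from [s] by factors [q] until one more step would
    pass [t], then use monotonicity of [G] at the cost of q^(-e). *)
Lemma almost_decreasing G q e : (forall s t, 0 <= s -> s <= t -> G s <= G t) ->
  (forall t, 0 <= t -> 0 <= G t) ->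
  0 <= e -> 0 < q < 1 ->
  (forall y, 0 < y -> G y * y `^ (- e) <= G (q * y) * (q * y) `^ (- e)) ->
  forall s t, 0 < t -> t <= s ->
    G s * s `^ (- e) <= q `^ (- e) * (G t * t `^ (- e)).
Proof.
move=> Gle G0 e0 /andP[q0 q1] step s t t0 ts; have s0 := lt_le_trans t0 ts.
have qV : 1 < q^-1 by rewrite invf_gt1.
have [n] := expr_unbounded (s / t) qV; rewrite ltr_pdivrMr // => hn.
elim: n s s0 ts hn => [|n ih] s s0 ts hn.
  by rewrite expr0 mul1r in hn; have := le_lt_trans ts hn; rewrite ltxx.
have qs0 : 0 < q * s by rewrite mulr_gt0.
apply: le_trans (step _ s0) _.
have [qst|tqs] := ltP (q * s) t; last first.
  apply: ih => //; rewrite -ltr_pdivlMl // mulrA -exprS //.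
rewrite mulrCA; apply: ler_pM; rewrite ?powR_ge0 ?G0 ?(ltW qs0) //.
  by apply: Gle; exact: ltW.
rewrite -powRM ?(ltW q0) ?(ltW t0) // !powRN lef_pV2 ?posrE ?powR_gt0 ?mulr_gt0 //.
by rewrite ge0_ler_powR // ?nnegrE ?mulr_ge0 ?(ltW q0) ?(ltW t0) ?(ltW s0) // ler_pM2l.
Qed.

End PowerGrowth.

Lemma weight_le (R : realFieldType) (k1 k2 w : R) : 0 <= k1 -> 0 <= k2 -> 0 <= w ->
  k1 <= (k1 + k2) * (1 + w) /\ k2 * w <= (k1 + k2) * (1 + w).
Proof. by move=> k10 k20 w0; split; nra. Qed.

(** One step gains the factor t^(1 - a d), which is at least 1 because t < 1 < a d. *)
Lemma nondecreasing_dilation (R : realType) (G : R -> R) (t a d : R) :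
  0 < t < 1 -> 1 < a * d -> (forall y, 0 <= y -> 0 <= G y) ->
  (forall y, 0 < y -> t * G y <= G (t `^ a * y)) ->
  forall y, 0 < y ->
    G y * y `^ (- d) <= G (t `^ a * y) * (t `^ a * y) `^ (- d).
Proof.
move=> /andP[t0 t1] ad G0 h y y0.
rewrite powRM ?powR_ge0 ?(ltW y0) // mulrA; apply: ler_wpM2r; first exact: powR_ge0.
apply: le_trans (ler_wpM2r (powR_ge0 _ _) (h y y0)).
rewrite mulrAC; apply: ler_peMl; first exact/G0/ltW.
rewrite -powRrM -[X in X * _]powRr1 ?(ltW t0) // -powRD; last first.
  by rewrite (gt_eqF t0) implybT.
by rewrite -[leLHS](powRr0 t) ger_powR ?t0 ?(ltW t1) // mulrN subr_le0 ltW.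
Qed.

(** * Growth of Psi_theta under the conditions on the indices *)

Section PsiTheta.
Variables (R : realType) (Phi : R -> R) (theta a b t0 t1 : R).
Hypothesis hPhi : half_line_bijection Phi.
Hypothesis theta01 : 0 < theta < 1.
Hypotheses (t0_01 : 0 < t0 < 1) (t1_gt1 : 1 < t1).
Hypothesis lower_dilation : forall u, 0 < u -> Phi (t0 * u) <= t0 `^ a * Phi u.
Hypothesis upper_dilation : forall u, 0 < u -> Phi (t1 * u) <= t1 `^ b * Phi u.
Hypotheses (a_large : 1 < a * (1 - theta / 2)) (b_gt0 : 0 < b).
Hypothesis b_small : b * (theta / 2) < 1.

Local Notation G := (inverse_half_line Phi).
Local Notation Psi := (Psi_theta Phi theta).
Let e := theta / 2.
Let p := t1 `^ b.
Let q := t0 `^ a.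
Let H y := G y * y `^ (- e).
Let gamma := (1 - theta)^-1.

(** The dilation bound at u = G y, read through the inverse function. *)
Lemma inverse_dilation t c y : 0 < t ->
  (forall u, 0 < u -> Phi (t * u) <= t `^ c * Phi u) ->
  0 < y -> t * G y <= G (t `^ c * y).
Proof.
move=> t_gt0 h y0; have y0' : 0 <= t `^ c * y by rewrite mulr_ge0 ?powR_ge0 ?ltW.
apply: (hlb_le_reflect hPhi); first exact: hlb_inverse_ge0.
rewrite (hlb_inverse hPhi).2 // (le_trans (h _ _)) //.
  exact: hlb_inverse_gt0.
by rewrite (hlb_inverse hPhi).2 // ltW.
Qed.

Let th0 : 0 < theta. Proof. by case/andP: theta01. Qed.
Let gamma_gt0 : 0 < gamma.
Proof. by rewrite invr_gt0 subr_gt0; case/andP: theta01. Qed.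
Let e_gt0 : 0 < e. Proof. by rewrite divr_gt0. Qed.
Let t1_gt0 : 0 < t1. Proof. exact: lt_trans ltr01 t1_gt1. Qed.
Let p_gt0 : 0 < p. Proof. exact: powR_gt0. Qed.
Let p_gt1 : 1 < p.
Proof.
have {1}<- : 1 `^ b = 1 :> R by rewrite powR1.
by rewrite gt0_ltr_powR ?nnegrE // ltW.
Qed.

(** Growth factor of [H] under dilation by [p]. It equals t1^(1 - b theta/2), above 1 because b
    theta/2 < 1. *)
Let kappa := t1 * p `^ (- e).
Let kappa_gt1 : 1 < kappa.
Proof.
rewrite /kappa /p -powRrM -[X in X * _]powRr1 ?(ltW t1_gt0) // -powRD; last first.
  by rewrite (gt_eqF t1_gt0) implybT.
have c0 : 0 < 1 + b * - e by rewrite mulrN subr_gt0.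
have {1}<- : 1 `^ (1 + b * - e) = 1 :> R by rewrite powR1.
by rewrite gt0_ltr_powR ?nnegrE // ltW.
Qed.

Let H_gt0 y : 0 < y -> 0 < H y.
Proof. by move=> y0; rewrite mulr_gt0 ?powR_gt0 // hlb_inverse_gt0. Qed.

Let H_step y : 0 < y -> kappa * H y <= H (p * y).
Proof.
move=> y0; rewrite /H powRM ?(ltW p_gt0) ?(ltW y0) //.
rewrite (_ : kappa * _ = t1 * G y * (p `^ (- e) * y `^ (- e))); last first.
  by rewrite /kappa; ring.
by rewrite ler_wpM2r ?mulr_ge0 ?powR_ge0 // inverse_dilation.
Qed.

Let H_iter n y : 0 < y -> kappa ^+ n * H y <= H (p ^+ n * y).
Proof.
move=> y0; elim: n => [|n ih]; first by rewrite !expr0 !mul1r.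
have pn0 : 0 < p ^+ n * y by rewrite mulr_gt0 // exprn_gt0.
rewrite !exprS -[p * _ * y]mulrA -[kappa * kappa ^+ n * _]mulrA.
apply: le_trans (H_step pn0).
by rewrite ler_wpM2l // ltW // (lt_trans ltr01).
Qed.

Let PsiE t : 0 < t -> Psi t = H t `^ gamma.
Proof. by move=> t_gt0; rewrite /Psi_theta gt_eqF. Qed.

Lemma Psi_theta0 : Psi 0 = 0.
Proof. by rewrite /Psi_theta eqxx. Qed.

Lemma Psi_theta_gt0 t : 0 < t -> 0 < Psi t.
Proof. by move=> t_gt0; rewrite PsiE // powR_gt0 // H_gt0. Qed.

(** The inverse of [Phi] is the Calderon product of Psi_theta and the square root, the inverse of
    the function defining l^2. *)
Lemma Psi_theta_product t : 0 <= t -> G t = Psi t `^ (1 - theta) * t `^ e.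
Proof.
rewrite le_eqVlt => /predU1P[<-|t_gt0].
  rewrite Psi_theta0 powR0 ?mul0r; last by rewrite gt_eqF // subr_gt0; case/andP: theta01.
  by rewrite -[X in G X](hlb0 hPhi) (hlb_inverse hPhi).1.
rewrite PsiE // -powRrM mulVf; last by rewrite gt_eqF // subr_gt0; case/andP: theta01.
rewrite powRr1; last exact/ltW/H_gt0.
by rewrite /H powRN divfK // gt_eqF // powR_gt0.
Qed.

Lemma Psi_theta_unbounded A : exists2 t, 0 < t & A <= Psi t.
Proof.
have A0 : 0 <= Num.max A 0 by rewrite le_max lexx orbT.
have [n hn] := expr_unbounded (Num.max A 0 `^ gamma^-1 / H 1) kappa_gt1.
exists (p ^+ n); first exact: exprn_gt0.
rewrite PsiE ?exprn_gt0 // (@le_trans _ _ (Num.max A 0)) ?le_max ?lexx //.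
rewrite -[leLHS]powRr1 // -(mulVf (lt0r_neq0 gamma_gt0)) powRrM.
rewrite ge0_ler_powR ?(ltW gamma_gt0) // ?nnegrE ?powR_ge0 //.
  by rewrite ltW // H_gt0 // exprn_gt0.
move: hn; rewrite ltr_pdivrMr ?H_gt0 // => /ltW /le_trans; apply.
by have := H_iter n ltr01; rewrite mulr1.
Qed.

(** [H_iter] is run from [p ^- n] up to 1, so [H (p ^- n)] is at most [H 1] divided by
    [kappa ^+ n]. *)
Lemma Psi_theta_small eps : 0 < eps -> exists2 t, 0 < t & Psi t <= eps.
Proof.
move=> eps0; have c0 : 0 < eps `^ gamma^-1 by rewrite powR_gt0.
have [n hn] := expr_unbounded (H 1 / eps `^ gamma^-1) kappa_gt1.
have pn0 : 0 < p ^- n by rewrite invr_gt0 exprn_gt0.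
exists (p ^- n) => //; rewrite PsiE //.
rewrite -[leRHS]powRr1 ?(ltW eps0) // -(mulVf (lt0r_neq0 gamma_gt0)) powRrM.
rewrite ge0_ler_powR ?(ltW gamma_gt0) // ?nnegrE ?powR_ge0 ?(ltW (H_gt0 _)) //.
have := H_iter n pn0; rewrite mulfV ?gt_eqF ?exprn_gt0 // => h.
have kn0 : 0 < kappa ^+ n by rewrite exprn_gt0 // (lt_trans ltr01).
rewrite -(ler_pM2l kn0) (le_trans h) //.
by rewrite ltr_pdivrMr // in hn; exact: ltW.
Qed.

(** Losses of [almost_increasing] and [almost_decreasing], raised to the power gamma because
    Psi_theta is H^gamma. *)
Definition Psi_theta_constant :=
  (p `^ e) `^ gamma + (q `^ (- (1 - theta / 2))) `^ gamma.

Lemma Psi_theta_constant_gt0 : 0 < Psi_theta_constant.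
Proof. by rewrite ltr_wpDr ?powR_ge0 // !powR_gt0. Qed.

(** For s <= t, [H] is almost increasing by the upper dilation bound. For s > t, H(y) y^(-(1-theta))
    = G(y) y^(-(1-theta/2)) is almost decreasing by the lower one; its power gamma is
    Psi_theta(y)/y. *)
Lemma Psi_theta_le s t : 0 < s -> 0 < t ->
  Psi s <= Psi_theta_constant * (1 + s / t) * Psi t.
Proof.
move=> s_gt0 t_gt0; rewrite !PsiE //.
have Gle := hlb_inverse_le hPhi; have Gge0 := hlb_inverse_ge0 hPhi.
set K1 := (p `^ e) `^ gamma; set K2 := (q `^ (- (1 - theta / 2))) `^ gamma.
have K10 : 0 <= K1 by exact: powR_ge0.
have K20 : 0 <= K2 by exact: powR_ge0.
have st0 : 0 <= s / t by rewrite divr_ge0 // ltW.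
have Hs : 0 <= H s `^ gamma by exact: powR_ge0.
have Ht : 0 <= H t `^ gamma by exact: powR_ge0.
have monoH x y : 0 <= x -> x <= y -> x `^ gamma <= y `^ gamma.
  move=> x0 xy; rewrite ge0_ler_powR ?(ltW gamma_gt0) // nnegrE //.
  exact: le_trans xy.
have [st|ts] := leP s t.
  apply: (@le_trans _ _ (K1 * H t `^ gamma)); last first.
    by apply: (ler_wpM2r Ht); exact: (weight_le K10 K20 st0).1.
  rewrite -powRM ?powR_ge0 ?(ltW (H_gt0 _)) //; apply: monoH.
    exact/ltW/H_gt0.
  apply: almost_increasing => //; first exact: ltW.
  move=> y y0; apply: le_trans (H_step y0); apply: ler_peMl; first exact/ltW/H_gt0.
  exact: ltW.
apply: (@le_trans _ _ (K2 * (s / t) * H t `^ gamma)); last first.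
  by apply: (ler_wpM2r Ht); exact: (weight_le K10 K20 st0).2.
have /andP[t00 t01] := t0_01; have /andP[_ th1] := theta01.
have e2 : 0 < 1 - theta / 2.
  by rewrite subr_gt0 ltr_pdivrMr // mul1r (lt_trans th1) // ltr1n.
have a0 : 0 < a by rewrite -(pmulr_lgt0 _ e2) (lt_trans ltr01).
have q0 : 0 < q by exact: powR_gt0.
have q01 : 0 < q < 1.
  rewrite q0 /=; have {1}<- : 1 `^ a = 1 :> R by rewrite powR1.
  by rewrite gt0_ltr_powR ?nnegrE // ltW.
have step := nondecreasing_dilation t0_01 a_large (@Gge0)
  (fun y => @inverse_dilation t0 a y t00 lower_dilation).
have := almost_decreasing Gle Gge0 (ltW e2) q01 step t_gt0 (ltW ts) => hL.
have HE x : 0 < x -> H x = G x * x `^ (- (1 - theta / 2)) * x `^ (1 - theta).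
  move=> x0; rewrite /H -mulrA -powRD; last by rewrite (gt_eqF x0) implybT.
  by congr (_ * _ `^ _); rewrite /e; field.
have E : K2 * (s / t) * H t `^ gamma =
    (q `^ (- (1 - theta / 2)) * ((s / t) `^ (1 - theta) * H t)) `^ gamma.
  have stE : ((s / t) `^ (1 - theta)) `^ gamma = s / t.
    by rewrite -powRrM mulfV ?powRr1 // gt_eqF // subr_gt0.
  have Ht0 := ltW (H_gt0 t_gt0).
  have sH0 := mulr_ge0 (powR_ge0 (s / t) (1 - theta)) Ht0.
  rewrite [RHS](powRM _ (powR_ge0 _ _) sH0).
  by rewrite [((s / t) `^ _ * _) `^ _](powRM _ (powR_ge0 _ _) Ht0) stE mulrA.
rewrite E; apply: monoH; first exact/ltW/H_gt0.
rewrite !HE // powRM ?invr_ge0 ?(ltW s_gt0) ?(ltW t_gt0) //.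
have tV : t^-1 `^ (1 - theta) * t `^ (1 - theta) = 1.
  by rewrite -powRM ?invr_ge0 ?(ltW t_gt0) // mulVf ?gt_eqF // powR1.
set x := s `^ (1 - theta).
rewrite [leRHS](_ : _ = q `^ (- (1 - theta / 2)) * (G t * t `^ (- (1 - theta / 2))) * x *
  (t^-1 `^ (1 - theta) * t `^ (1 - theta))); last by ring.
by rewrite tV mulr1 ler_wpM2r ?powR_ge0.
Qed.

End PsiTheta.

(** * The sequence spaces, their sum, and operator norms *)

Section SequenceSpaces.
Variable R : realType.
Implicit Types (f g : int -> R[i]) (X : set (int -> R[i])) (N : (int -> R[i]) -> R).
Local Notation sq := (fun t : R => t ^+ 2).

Lemma square_young : young sq.
Proof.
split=> [x _|x y x0 xy||p x y /andP[p0 p1] x0 y0].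
- exact: sqr_ge0.
- by rewrite lerXn2r ?nnegrE // (le_trans x0).
- by rewrite expr0n.
- rewrite -subr_ge0.
  rewrite (_ : _ - _ = p * (1 - p) * (x - y) ^+ 2); last by ring.
  by apply: mulr_ge0 (sqr_ge0 _); rewrite mulr_ge0 // subr_ge0.
Qed.

Lemma ell2P f : ell2 f <-> exists B, sums_le (fun n => modulus (f n) ^+ 2) B.
Proof. by apply: esum_lt_pinftyP => n; exact: sqr_ge0. Qed.

Lemma ell2_orlicz : @ell2 R = orlicz sq.
Proof.
apply/seteqP; split => f.
  move=> /ell2P[B hB]; exists 1 => //.
  rewrite modular_divE //; apply/esum_lt_pinftyP; first by move=> n; exact: sqr_ge0.
  by exists B; under eq_fun do rewrite divr1.
move=> /(orliczP square_young)[l l0 h]; apply/ell2P; exists (l ^+ 2 * 1).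
have := sums_leZ (sqr_ge0 l) h; apply: sums_le_mono => n.
by rewrite -exprMn mulrC divfK // gt_eqF.
Qed.

Lemma ell2_norm_le1 f : sums_le (fun n => modulus (f n) ^+ 2) 1 -> ell2_norm f <= 1.
Proof.
move=> h; have /esum_leP h1 := h.
rewrite /ell2_norm -sqrtr1 ler_wsqrtr //.
have e0 : (0 <= ell2_sum f)%E by apply: esum_ge0 => n _; rewrite lee_fin sqr_ge0.
by rewrite -lee_fin fineK // ge0_fin_numE // (le_lt_trans h1) // ltry.
Qed.

Lemma ell2_norm_lt f M : ell2 f -> ell2_norm f < M ->
  sums_le (fun n => (modulus (f n) / M) ^+ 2) 1.
Proof.
move=> hf fM; have M0 : 0 < M by rewrite (le_lt_trans _ fM) // sqrtr_ge0.
have e0 : (0 <= ell2_sum f)%E by apply: esum_ge0 => n _; rewrite lee_fin sqr_ge0.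
have hs : sums_le (fun n => modulus (f n) ^+ 2) (M ^+ 2).
  apply/esum_leP; rewrite -/(ell2_sum f) -[leLHS]fineK ?ge0_fin_numE // lee_fin.
  have r0 : 0 <= fine (ell2_sum f) by exact: fine_ge0.
  by rewrite -[leLHS]sqr_sqrtr // lerXn2r ?nnegrE ?sqrtr_ge0 // ltW.
have := sums_leZ (_ : 0 <= (M ^+ 2)^-1) hs.
rewrite mulVf ?gt_eqF ?exprn_gt0 // => /(_ (ltac:(by rewrite invr_ge0 sqr_ge0))).
by apply: sums_le_mono => n; rewrite exprMn exprVn mulrC.
Qed.

Lemma orlicz0 (Y : R -> R) : young Y -> orlicz Y (fun=> 0).
Proof.
move=> yY; apply/(orliczP yY); exists 1 => // s _.
by rewrite big1 // => n _; rewrite modulus0 mul0r (young0 yY).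
Qed.

Lemma orlicz_norm0_le1 (Y : R -> R) : young Y -> orlicz_norm Y (fun=> 0) <= 1.
Proof.
move=> yY; apply: orlicz_norm_le => // s _.
by rewrite big1 // => n _; rewrite modulus0 mul0r (young0 yY).
Qed.

Lemma sum_space_domain (Y0 Y1 : R -> R) : young Y0 -> young Y1 ->
  linear_domain (sum_space (orlicz Y0) (orlicz Y1)).
Proof.
move=> yY0 yY1; split.
  exists (fun=> 0); first exact: orlicz0.
  exists (fun=> 0); first exact: orlicz0.
  by apply/funext => n; rewrite addr0.
move=> a _ _ [f0 hf0 [f1 hf1 <-]] [g0 hg0 [g1 hg1 <-]].
exists (fun n => a * f0 n + g0 n); first exact: orlicz_combination.
exists (fun n => a * f1 n + g1 n); first exact: orlicz_combination.
by apply/funext => n; ring.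
Qed.

Lemma sum_spacel X X' f : X' (fun=> 0) -> X f -> sum_space X X' f.
Proof.
move=> h Xf; exists f => //; exists (fun=> 0) => //.
by apply/funext => n; rewrite addr0.
Qed.

Lemma sum_spacer X X' f : X (fun=> 0) -> X' f -> sum_space X X' f.
Proof.
move=> h Xf; exists (fun=> 0) => //; exists f => //.
by apply/funext => n; rewrite add0r.
Qed.

Lemma operator_norm_ub X N T f : (forall g, X g -> 0 <= N g) ->
  bounded_operator X N T -> X f -> N f <= 1 -> N (T f) <= operator_norm X N T.
Proof.
move=> N0 [_ [c hc]] Xf Nf; apply: ub_le_sup; last by exists f.
(* The constant of a bounded operator may be negative, hence the absolute value. *)
exists `|c| => _ [g [Xg Ng] <-]; apply: le_trans (hc _ Xg) _.
apply: (@le_trans _ _ (`|c| * N g)); first by rewrite ler_wpM2r ?N0 // ler_norm.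
by rewrite -[leRHS]mulr1 ler_wpM2l.
Qed.

Lemma modular_bounded_orlicz (D : set (int -> R[i])) (Y : R -> R) T M : young Y ->
  orlicz Y `<=` D -> bounded_operator (orlicz Y) (orlicz_norm Y) T ->
  operator_norm (orlicz Y) (orlicz_norm Y) T < M -> modular_bounded D T Y M.
Proof.
move=> yY XD bT TM f hf.
have hf1 : sums_le (fun n => Y (modulus (f n) / 1)) 1.
  by under eq_fun do rewrite divr1.
have Xf : orlicz Y f by apply/(orliczP yY); exists 1.
split; first exact: XD.
apply: (orlicz_norm_lt yY); first exact: bT.1.
apply: le_lt_trans TM; apply: operator_norm_ub => //.
  by move=> g Xg; exact: orlicz_norm_ge0.
exact: orlicz_norm_le.
Qed.

Lemma modular_bounded_ell2 (D : set (int -> R[i])) T M :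
  @ell2 R `<=` D -> bounded_operator (@ell2 R) (@ell2_norm R) T ->
  operator_norm (@ell2 R) (@ell2_norm R) T < M -> modular_bounded D T sq M.
Proof.
move=> XD bT TM f hf; have Xf : ell2 f by apply/ell2P; exists 1.
split; first exact: XD.
apply: ell2_norm_lt; first exact: bT.1.
apply: le_lt_trans TM; apply: operator_norm_ub => //.
  by move=> g Xg; exact: sqrtr_ge0.
exact: ell2_norm_le1.
Qed.

Lemma le_powR_limit (x A o e : R) : 0 <= A -> 0 <= o -> 0 < e ->
  (forall M, o < M -> x <= A * M `^ e) -> x <= A * o `^ e.
Proof.
rewrite le_eqVlt => /predU1P[<-|A0] o0 e0 h.
  by have := h (o + 1); rewrite !mul0r; apply; rewrite ltrDl.
rewrite leNgt -ltr_pdivlMl // mulrC; apply/negP => lt.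
(* Were [x / A] above o^e, M = z^(1/e) would exceed [o] while A M^e = A z stayed below [x]. *)
pose z := (o `^ e + x / A) / 2.
have oe := powR_ge0 o e.
have z0 : 0 <= z by rewrite /z; lra.
have : x <= A * z.
  rewrite -[z]powRr1 // -(mulVf (lt0r_neq0 e0)) powRrM; apply: h.
  rewrite -[ltLHS]powRr1 // -(mulfV (lt0r_neq0 e0)) powRrM.
  rewrite gt0_ltr_powR ?invr_gt0 // ?nnegrE ?powR_ge0 // /z; lra.
by rewrite mulrC -ler_pdivrMr // /z; lra.
Qed.

End SequenceSpaces.

(** * From the pointwise bound back to l^Phi *)

Section MainEstimate.
Variables (R : realType) (Phi : R -> R) (theta K : R).
Hypothesis yPhi : young Phi.
Hypothesis hPhi : half_line_bijection Phi.
Hypothesis theta01 : 0 < theta < 1.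
Local Notation G := (inverse_half_line Phi).
Local Notation Psi := (Psi_theta Phi theta).
Local Notation m := (least_concave_majorant Psi).
Local Notation Y0 := (Phi_theta Phi theta).
Local Notation Y1 := (fun t : R => t ^+ 2).
Hypothesis hm : half_line_bijection m.
Hypothesis yY0 : young Y0.
Hypothesis K_gt0 : 0 < K.
Hypothesis Psi_le_m : forall t, 0 <= t -> Psi t <= m t.
Hypothesis m_le_Psi : forall t, 0 < t -> m t <= K * Psi t.
Hypothesis Psi_ge0 : forall t, 0 <= t -> 0 <= Psi t.
Hypothesis GE : forall t, 0 <= t -> G t = Psi t `^ (1 - theta) * t `^ (theta / 2).

Let th1 : 0 < 1 - theta. Proof. by rewrite subr_gt0; case/andP: theta01. Qed.
Let th0 : 0 < theta. Proof. by case/andP: theta01. Qed.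
Let Y0m t : 0 <= t -> Y0 (m t) = t. Proof. exact: (hlb_inverse hm).1. Qed.
Let mY0 t : 0 <= t -> m (Y0 t) = t. Proof. exact: (hlb_inverse hm).2. Qed.

Let sqrt_powR (t : R) : 0 <= t -> Num.sqrt t `^ theta = t `^ (theta / 2).
Proof. by move=> t0; rewrite -powR12_sqrt // -powRrM mulrC. Qed.

(** The sum dominates both summands, so a single argument [s] serves for x0 <= m(s) and x1 <=
    sqrt(s). Then m <= K Psi_theta and the product formula for [G] apply. *)
Lemma product_le_inverse x0 x1 : 0 <= x0 -> 0 <= x1 ->
  x0 `^ (1 - theta) * x1 `^ theta <=
  K `^ (1 - theta) * G (Y0 x0 + x1 ^+ 2).
Proof.
move=> x0_ge0 x1_ge0; set s := Y0 x0 + x1 ^+ 2.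
have y0 : 0 <= Y0 x0 by exact: young_ge0 yY0 _ _.
have s0 : 0 <= s by rewrite addr_ge0 // sqr_ge0.
have h0 : x0 `^ (1 - theta) <= m s `^ (1 - theta).
  have x0m : x0 <= m s by rewrite -{1}[x0]mY0 // hlb_le // lerDl sqr_ge0.
  by rewrite ge0_ler_powR ?(ltW th1) // nnegrE // (le_trans x0_ge0).
have h1 : x1 `^ theta <= s `^ (theta / 2).
  rewrite -sqrt_powR // ge0_ler_powR ?(ltW th0) // ?nnegrE ?sqrtr_ge0 //.
  by rewrite -[leLHS]ger0_norm // -sqrtr_sqr ler_wsqrtr // lerDr.
apply: le_trans (ler_pM _ _ h0 h1) _; rewrite ?powR_ge0 //.
rewrite GE // mulrA; apply: ler_wpM2r; first exact: powR_ge0.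
rewrite -powRM ?(ltW K_gt0) ?Psi_ge0 //.
move: (s0); rewrite le_eqVlt => /predU1P[s_eq|s_gt0].
  by rewrite -s_eq hlb0 // powR0 ?powR_ge0 // gt_eqF.
rewrite ge0_ler_powR ?(ltW th1) // ?nnegrE ?m_le_Psi //.
  exact: hlb_ge0 hm _ s0.
by rewrite mulr_ge0 ?Psi_ge0 // ltW.
Qed.

(** Supplies an error that can be absorbed into half of every nonzero value on a finite list. *)
Lemma small_half (f : int -> R[i]) (s : seq int) :
  exists2 eps, 0 < eps &
    forall n, n \in s -> modulus (f n) != 0 -> eps <= modulus (f n) / 2.
Proof.
elim: s => [|n s [eps eps0 h]]; first by exists 1.
have [fn|fn] := eqVneq (modulus (f n)) 0.
  by exists eps => // k; rewrite inE => /predU1P[->|/h//]; rewrite fn eqxx.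
have fn0 : 0 < modulus (f n) by rewrite lt_neqAle eq_sym fn modulus_ge0.
exists (Num.min eps (modulus (f n) / 2)); first by rewrite lt_min eps0 divr_gt0.
move=> k; rewrite inE => /predU1P[->|ks] fk; first by rewrite ge_min lexx orbT.
by rewrite ge_min h.
Qed.

Variables (D : set (int -> R[i])) (T : (int -> R[i]) -> (int -> R[i])).
Hypothesis hD : linear_domain D.
Hypothesis hT : forall a f g, D f -> D g ->
  T (fun n => a * f n + g n) = (fun n => a * T f n + T g n).

(** One factor 2 absorbs eps, the other halves the sum of two modulars; K^(1-theta) is the cost of
    replacing the majorant by Psi_theta. *)
Definition interpolation_constant := 4 * (calderon_constant theta * K `^ (1 - theta)).
Local Notation C := interpolation_constant.

Lemma interpolation_constant_gt0 : 0 < C.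
Proof. by rewrite !mulr_gt0 ?powR_gt0 ?calderon_constant_gt0. Qed.

Lemma modular_estimate M0 M1 f : 0 < M0 -> 0 < M1 ->
  modular_bounded D T Y0 M0 -> modular_bounded D T Y1 M1 ->
  sums_le (fun n => Phi (modulus (f n))) 1 ->
  D f /\ sums_le (fun n =>
    Phi (modulus (T f n) / (C * M0 `^ (1 - theta) * M1 `^ theta))) 1.
Proof.
move=> M0_gt0 M1_gt0 bY0 bY1 hf.
pose t n := Phi (modulus (f n)).
have t0 n : 0 <= t n by apply: (young_ge0 yPhi); exact: modulus_ge0.
pose g0 n := m (t n); pose g1 n := Num.sqrt (t n).
have g0_ge0 n : 0 <= g0 n by exact: hlb_ge0 hm _ (t0 n).
have g1_ge0 n : 0 <= g1 n by exact: sqrtr_ge0.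
have fle n : modulus (f n) <= g0 n `^ (1 - theta) * g1 n `^ theta.
  have -> : modulus (f n) = G (t n) by rewrite (hlb_inverse hPhi).1 // modulus_ge0.
  rewrite GE // sqrt_powR //; apply: ler_wpM2r; first exact: powR_ge0.
  by rewrite ge0_ler_powR ?(ltW th1) // ?nnegrE ?Psi_ge0 // Psi_le_m.
have hg0 : sums_le (fun n => Y0 (g0 n)) 1.
  by apply: sums_le_mono hf => n; rewrite Y0m.
have hg1 : sums_le (fun n => g1 n ^+ 2) 1.
  by apply: sums_le_mono hf => n; rewrite sqr_sqrtr.
have hu0 x : 0 <= x -> Y0 x <= 1 -> x <= m 1.
  move=> x0 Yx; rewrite -[x]mY0 //; apply: (hlb_le hm) => //.
  exact: young_ge0 yY0 _ _.
have hu1 (x : R) : 0 <= x -> x ^+ 2 <= 1 -> x <= 1.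
  by move=> x0; rewrite expr_le1.
have [Df hTf] := calderon_interpolation hD hT yY0 (square_young R) M0_gt0 M1_gt0
  bY0 bY1 hu0 hu1 theta01 g0_ge0 g1_ge0 fle hg0 hg1.
split=> // s us.
(* Here [eps], and with it [h0] and [h1], may depend on [s]: only the partial sum over [s] has to be
   bounded, and the constant is the same for all [s]. *)
have [eps eps0 heps] := small_half (T f) s.
have [h0 [h1 [h0_ge0 h1_ge0 hh0 hh1 hle]]] := hTf _ eps0.
pose x0 n := h0 n / M0; pose x1 n := h1 n / M1.
have x0_ge0 n : 0 <= x0 n by rewrite divr_ge0 // ltW.
have x1_ge0 n : 0 <= x1 n by rewrite divr_ge0 // ltW.
have Y0x n : 0 <= Y0 (x0 n) by apply: (young_ge0 yY0).
pose S n := Y0 (x0 n) + x1 n ^+ 2.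
have S0 n : 0 <= S n by rewrite addr_ge0 // sqr_ge0.
pose c := calderon_constant theta * K `^ (1 - theta).
pose M := M0 `^ (1 - theta) * M1 `^ theta.
have c0 : 0 < c by rewrite mulr_gt0 ?powR_gt0 ?calderon_constant_gt0.
have M_gt0 : 0 < M by rewrite mulr_gt0 ?powR_gt0.
have cM : 0 < 2 * (c * M) by exact: mulr_gt0 (ltr0n _ 2) (mulr_gt0 c0 M_gt0).
have CM : C * M0 `^ (1 - theta) * M1 `^ theta = 2 * (2 * (c * M)).
  by rewrite /interpolation_constant /M /c; ring.
have key n : n \in s -> modulus (T f n) <= 2 * (c * M) * G (S n).
  move=> ns; have [->|Tfn] := eqVneq (modulus (T f n)) 0.
    by apply: mulr_ge0 (ltW cM) _; exact: hlb_inverse_ge0.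
  have hprod : h0 n `^ (1 - theta) * h1 n `^ theta <= M * (K `^ (1 - theta) * G (S n)).
    have -> : h0 n = M0 * x0 n by rewrite /x0 mulrC divfK // gt_eqF.
    have -> : h1 n = M1 * x1 n by rewrite /x1 mulrC divfK // gt_eqF.
    rewrite (powRM _ (ltW M0_gt0) (x0_ge0 n)) (powRM _ (ltW M1_gt0) (x1_ge0 n)).
    rewrite mulrACA; apply: (ler_wpM2l (ltW M_gt0)).
    exact: product_le_inverse.
  have := ler_wpM2l (ltW (calderon_constant_gt0 theta01)) hprod.
  rewrite (_ : _ * (M * _) = c * M * G (S n)); last by rewrite /c; ring.
  have := hle n; have := heps n ns Tfn; lra.
have half n : n \in s ->
    Phi (modulus (T f n) / (C * M0 `^ (1 - theta) * M1 `^ theta)) <= 2^-1 * S n.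
  move=> ns; rewrite CM invfM mulrCA.
  have y0 : 0 <= modulus (T f n) / (2 * (c * M)).
    by rewrite divr_ge0 ?modulus_ge0 // ltW.
  have p01 : 0 <= (2^-1 : R) <= 1 by rewrite invr_ge0 ler0n invf_le1 // ler1n.
  apply: le_trans (youngZ yPhi p01 y0) _; rewrite ler_pM2l ?invr_gt0 //.
  rewrite -[leRHS](hlb_inverse hPhi).2 //; apply: (young_le yPhi) => //.
  by rewrite ler_pdivrMr // mulrC; exact: key.
have := sums_leZ (_ : 0 <= 2^-1) (sums_leD hh0 hh1) us.
rewrite (_ : 2^-1 * (1 + 1) = 1 :> R); last by field.
move=> /(_ (ltac:(by rewrite invr_ge0))); apply: le_trans.
rewrite big_seq [leRHS]big_seq; apply: ler_sum => n ns; exact: half.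
Qed.

Lemma orlicz_estimate M0 M1 f : 0 < M0 -> 0 < M1 ->
  modular_bounded D T Y0 M0 -> modular_bounded D T Y1 M1 -> orlicz Phi f ->
  orlicz Phi (T f) /\ orlicz_norm Phi (T f) <=
    C * M0 `^ (1 - theta) * M1 `^ theta * orlicz_norm Phi f.
Proof.
move=> M0_gt0 M1_gt0 bY0 bY1 Xf; set L := C * _ * _.
have L0 : 0 < L.
  exact: mulr_gt0 (mulr_gt0 interpolation_constant_gt0 (powR_gt0 _ M0_gt0))
    (powR_gt0 _ M1_gt0).
(* Homogeneity: the modular estimate is applied to [f] divided by [mu], which is positive even when
   the norm of [f] is 0. *)
have scaled mu : orlicz_norm Phi f < mu -> 0 < mu /\
    sums_le (fun n => Phi (modulus (T f n) / (mu * L))) 1.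
  move=> fmu; have mu0 := le_lt_trans (orlicz_norm_ge0 yPhi Xf) fmu.
  have hmu : sums_le (fun n => Phi (modulus (seq_div f mu n))) 1.
    apply: sums_le_mono (orlicz_norm_lt yPhi Xf fmu) => n.
    by rewrite modulus_div_real.
  have [Dg hg] := modular_estimate M0_gt0 M1_gt0 bY0 bY1 hmu.
  split=> //; apply: sums_le_mono hg => n.
  have mune : (mu%:C)%C != 0 :> R[i] by rewrite fmorph_eq0 gt_eqF.
  have -> : T f = fun n => (mu%:C)%C * T (seq_div f mu) n.
    rewrite -(operator_scale hD hT _ Dg); congr T; apply/funext => k.
    by rewrite /seq_div mulrC divfK.
  rewrite modulusM modulus_real gtr0_norm // invfM mulrACA mulfV ?gt_eqF //.
  by rewrite mul1r.
have Lmu mu : 0 < mu -> 0 < mu * L by move=> ?; rewrite mulr_gt0.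
split.
  have [mu0 h] := scaled (orlicz_norm Phi f + 1) (ltac:(by rewrite ltrDl)).
  by apply/(orliczP yPhi); exists ((orlicz_norm Phi f + 1) * L) => //; exact: Lmu.
rewrite mulrC -ler_pdivrMr //; apply/ler_addgt0Pr => d d0.
have [mu0 h] := scaled (orlicz_norm Phi f + d) (ltac:(by rewrite ltrDl)).
by rewrite ler_pdivrMr // orlicz_norm_le // Lmu.
Qed.

End MainEstimate.

Theorem theorem3p5 (R : realType) (Phi : R -> R) (theta : R)
    (hPhi : N_function Phi)
    (halpha : (1 < MO_alpha Phi)%E)
    (halphabeta : (MO_alpha Phi <= MO_beta Phi)%E)
    (hbeta : (MO_beta Phi < +oo)%E)
    (htheta0 : 0 < theta)
    (htheta : theta < 2 * Num.min ((fine (MO_beta Phi))^-1)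
                                  (1 - (fine (MO_alpha Phi))^-1)) :
  exists2 C : R, 0 < C &
    forall T : (int -> R[i]) -> (int -> R[i]),
      linear_operator (sum_space (orlicz (Phi_theta Phi theta)) (@ell2 R)) T ->
      bounded_operator (orlicz (Phi_theta Phi theta))
                       (orlicz_norm (Phi_theta Phi theta)) T ->
      bounded_operator (@ell2 R) (@ell2_norm R) T ->
      bounded_operator (orlicz Phi) (orlicz_norm Phi) T /\
      operator_norm (orlicz Phi) (orlicz_norm Phi) T <=
        C * operator_norm (orlicz (Phi_theta Phi theta))
                          (orlicz_norm (Phi_theta Phi theta)) T `^ (1 - theta)
          * operator_norm (@ell2 R) (@ell2_norm R) T `^ theta.
Proof.
have yPhi := N_function_young hPhi; have bPhi := N_function_bijection hPhi.
have Phi_gt0 u : 0 < u -> 0 < Phi u.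
  by move=> u0; have := hlb_lt bPhi (lexx 0) u0; rewrite (hlb0 bPhi).
have alpha_fin : MO_alpha Phi \is a fin_num.
  rewrite fin_numElt (le_lt_trans halphabeta hbeta) andbT.
  by rewrite (lt_trans _ halpha) // ltNyr.
have beta_fin : MO_beta Phi \is a fin_num.
  rewrite fin_numElt hbeta andbT (lt_le_trans _ halphabeta) //.
  by rewrite (lt_trans _ halpha) // ltNyr.
set alpha := fine (MO_alpha Phi) in htheta; set beta := fine (MO_beta Phi) in htheta.
have alphaE : MO_alpha Phi = alpha%:E by rewrite /alpha fineK.
have betaE : MO_beta Phi = beta%:E by rewrite /beta fineK.
rewrite alphaE betaE lee_fin in halphabeta; rewrite alphaE lte_fin in halpha.
have beta1 : 1 < beta by exact: lt_le_trans halphabeta.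
have alpha0 := lt_trans ltr01 halpha; have beta0 := lt_trans ltr01 beta1.
have [th_beta th_alpha] : theta / 2 < beta^-1 /\ theta / 2 < 1 - alpha^-1.
  by apply/andP; rewrite -lt_min ltr_pdivrMr // mulrC.
have beta_alpha : beta^-1 <= alpha^-1 by rewrite lef_pV2.
(* theta/2 is below both 1/alpha and 1 - 1/alpha, which add up to 1. *)
have theta1 : theta < 1 by lra.
have theta01 : 0 < theta < 1 by rewrite htheta0.
have thc0 : 0 < 1 - theta / 2 by lra.
(* The strict bounds on theta leave room for [a] between 1/(1 - theta/2) and alpha, and below for
   [b] between beta and 2/theta, so the indices need not be attained. *)
have [a a_lt a_large] : exists2 a, (a < alpha) & 1 < a * (1 - theta / 2).
  have inv_lt : (1 - theta / 2)^-1 < alpha.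
    by rewrite -[alpha]invrK ltf_pV2 ?posrE ?invr_gt0 //; lra.
  have := midf_lt inv_lt; set a := (_ + _) / 2 => -[a1 a2].
  by exists a => //; rewrite -ltr_pdivrMr // mul1r.
have [b b_gt b_small] : exists2 b, (beta < b) & b * (theta / 2) < 1.
  have th2 : 0 < theta / 2 by rewrite divr_gt0.
  have lt_inv : beta < (theta / 2)^-1.
    by rewrite -[beta]invrK ltf_pV2 ?posrE ?invr_gt0.
  have := midf_lt lt_inv; set b := (_ + _) / 2 => -[b1 b2].
  by exists b => //; rewrite -ltr_pdivlMr // mul1r.
have b0 : 0 < b by exact: lt_trans b_gt.
have [|t0 t0_01 lower] := @MO_alpha_dilation _ Phi Phi_gt0 a.
  by rewrite alphaE lte_fin.
have [|t1 t1_gt1 upper] := @MO_beta_dilation _ Phi Phi_gt0 b.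
  by rewrite betaE lte_fin.
pose Psi := Psi_theta Phi theta.
pose K := Psi_theta_constant theta a b t0 t1.
have Psi0 : Psi 0 = 0 by exact: Psi_theta0.
have Psi_gt0 t : 0 < t -> 0 < Psi t by exact: Psi_theta_gt0.
have K0 : 0 < K by exact: Psi_theta_constant_gt0.
have Psi_le s t : 0 < s -> 0 < t -> Psi s <= K * (1 + s / t) * Psi t.
  exact: Psi_theta_le.
have Psi_unbounded A : exists2 t, 0 < t & A <= Psi t.
  exact: (Psi_theta_unbounded bPhi theta01 t1_gt1 upper).
have Psi_small eps : 0 < eps -> exists2 t, 0 < t & Psi t <= eps.
  exact: (Psi_theta_small bPhi theta01 t1_gt1 upper).
have Psi_ge0 t : 0 <= t -> 0 <= Psi t.
  by rewrite le_eqVlt => /predU1P[<-|/Psi_gt0/ltW//]; rewrite Psi0.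
have hm := majorant_bijection Psi0 Psi_gt0 K0 Psi_le Psi_unbounded Psi_small.
have yY0 : young (Phi_theta Phi theta).
  exact: (majorant_inverse_young Psi0 Psi_gt0 K0 Psi_le Psi_unbounded Psi_small).
have K2 : 0 < 2 * K by rewrite mulr_gt0.
exists (interpolation_constant theta (2 * K)).
  exact: interpolation_constant_gt0.
set C := interpolation_constant _ _ => T [_ hT] bT0 bT1.
have C0 : 0 < C by exact: interpolation_constant_gt0.
set o0 := operator_norm (orlicz (Phi_theta _ _)) _ T.
set o1 := operator_norm (@ell2 R) _ T.
set D := sum_space _ _ in hT.
have hD : linear_domain D.
  by rewrite /D ell2_orlicz; apply: sum_space_domain => //; exact: square_young.
have X0 := orlicz0 yY0.
have X1 : @ell2 R (fun=> 0) by rewrite ell2_orlicz; exact: orlicz0 (square_young R).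
have estimate M0 M1 f : o0 < M0 -> o1 < M1 -> 0 < M0 -> 0 < M1 -> orlicz Phi f ->
    orlicz Phi (T f) /\ orlicz_norm Phi (T f) <=
      C * M0 `^ (1 - theta) * M1 `^ theta * orlicz_norm Phi f.
  move=> oM0 oM1 M0_gt0 M1_gt0.
  apply: (orlicz_estimate yPhi bPhi theta01 hm yY0 K2 _ _ Psi_ge0 _ hD hT M0_gt0 M1_gt0).
  - by move=> t t_ge0; exact: (majorant_above Psi0 Psi_gt0 K0 Psi_le).
  - by move=> t t_gt0; exact: (majorant_le_Psi Psi0 Psi_gt0 K0 Psi_le).
  - by move=> t t_ge0; exact: (Psi_theta_product bPhi theta01).
  - by apply: (modular_bounded_orlicz yY0 _ bT0 oM0) => g Xg; exact: sum_spacel.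
  - by apply: (modular_bounded_ell2 _ bT1 oM1) => g Xg; exact: sum_spacer.
have o0_ge0 : 0 <= o0.
  apply: le_trans (operator_norm_ub _ bT0 X0 (orlicz_norm0_le1 yY0)).
    by apply: (orlicz_norm_ge0 yY0); exact: bT0.1.
  by move=> g; exact: orlicz_norm_ge0.
have o1_ge0 : 0 <= o1.
  apply: le_trans (operator_norm_ub _ bT1 X1 _); first exact: sqrtr_ge0.
    by move=> g _; exact: sqrtr_ge0.
  by apply: ell2_norm_le1 => s _; rewrite big1 // => n _; rewrite modulus0 expr0n.
have o0_lt : o0 < o0 + 1 by rewrite ltrDl.
have o1_lt : o1 < o1 + 1 by rewrite ltrDl.
have o0_pos : 0 < o0 + 1 by exact: le_lt_trans o0_lt.
have o1_pos : 0 < o1 + 1 by exact: le_lt_trans o1_lt.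
split; first split.
- by move=> f Xf; exact: (estimate _ _ f o0_lt o1_lt o0_pos o1_pos Xf).1.
- exists (C * (o0 + 1) `^ (1 - theta) * (o1 + 1) `^ theta) => f Xf.
  exact: (estimate _ _ f o0_lt o1_lt o0_pos o1_pos Xf).2.
have thc : 0 < 1 - theta by rewrite subr_gt0.
(* The two operator norms are approached from above one after the other, with the other factors
   frozen. *)
rewrite mulrAC; apply: le_powR_limit => // [|M0 oM0].
  by rewrite mulr_ge0 ?powR_ge0 // ltW.
rewrite mulrAC; apply: le_powR_limit => // [|M1 oM1].
  by rewrite mulr_ge0 ?powR_ge0 // ltW.
have M0_gt0 := le_lt_trans o0_ge0 oM0; have M1_gt0 := le_lt_trans o1_ge0 oM1.
apply: ge_sup.
  exists (orlicz_norm Phi (T (fun=> 0))), (fun=> 0) => //.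
  by split; [exact: orlicz0|exact: orlicz_norm0_le1].
move=> _ [f [Xf Nf] <-].
apply: le_trans (estimate M0 M1 f oM0 oM1 M0_gt0 M1_gt0 Xf).2 _.
have L0 : 0 <= C * M0 `^ (1 - theta) * M1 `^ theta.
  exact: mulr_ge0 (mulr_ge0 (ltW C0) (powR_ge0 _ _)) (powR_ge0 _ _).
by apply: le_trans (ler_wpM2l L0 Nf) _; rewrite mulr1 mulrAC.
Qed.
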